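(* Let $0<p<\infty$ with $p\ne2$. Then there exists $\omega\in\mathcal{I}$ such that, for any function $\varphi:[0,1)\to(0,\infty)$, the relation $$\|f\|^p_{A^p_\omega}\asymp\int_{\mathbb{D}}|f'(z)|^p\varphi(|z|)^p\omega(z)\,dA(z)+|f(0)|^p$$ (with constants of comparison independent of $f$) cannot be valid for all $f\in\mathcal{H}(\mathbb{D})$.
   Context: $\mathbb{D}$ is the open unit disc, $\mathcal{H}(\mathbb{D})$ the set of analytic functions in $\mathbb{D}$, $dA=\frac{dx\,dy}{\pi}$. A weight is a function $\omega:\mathbb{D}\to(0,\infty)$ integrable over $\mathbb{D}$; it is radial if $\omega(z)=\omega(|z|)$. $\mathcal{I}$ (rapidly increasing weights) is the class of continuous radial weights with $\lim_{r\to1^-}\frac{1}{\omega(r)(1-r)}\int_r^1\omega(s)\,ds=\infty$. $\|f\|_{A^p_\omega}^p=\int_{\mathbb{D}}|f|^p\omega\,dA$ (possibly $+\infty$). Functions $\varphi$ are understood to be measurable. The notation $a\asymp b$ means $C^{-1}b\le a\le Cb$ for a constant $C\ge1$. *)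

(* Defs.v *)
From HB Require Import structures.
From mathcomp Require Import all_boot all_order all_algebra.
From mathcomp Require Import all_classical all_reals all_analysis.
From mathcomp Require Import measurable_realfun.
From mathcomp Require Export complex.

Set Implicit Arguments.
Unset Strict Implicit.
Unset Printing Implicit Defensive.
Import Order.TTheory GRing.Theory Num.Theory.
Import numFieldNormedType.Exports.
Local Open Scope classical_set_scope.
Local Open Scope ring_scope.
Local Open Scope complex_scope.

(* The complex plane is R[i]^o, i.e. R[i] with its canonical structure of
   normed module over itself; in this way [derivable f z 1] is complex
   differentiability at z and [derive1 f] is the complex derivative. The norm
   `|z| lives in R[i]; [cabs z] is the same number seen in R. *)
Definition cabs (R : realType) (z : R[i]^o) : R := ComplexField.Normc.normc z.

Definition unit_disc (R : realType) : set R[i]^o := [set z | cabs z < 1].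

Definition analytic_in_disc (R : realType) (f : R[i]^o -> R[i]^o) : Prop :=
  forall z, unit_disc z -> derivable f z 1.

Lemma invpi_ge0 (R : realType) : 0 <= (pi : R)^-1.
Proof. by rewrite invr_ge0 pi_ge0. Qed.

(* dA = dx dy / pi. R[i] carries no measurable structure in the library, so
   dA lives on R * R and [toC] identifies R * R with the complex plane. *)
Definition dA (R : realType) : 
    {measure set (measurableTypeR R * measurableTypeR R) -> \bar R} :=
  mscale (NngNum (invpi_ge0 R)) (lebesgue_measure \x lebesgue_measure)%E.

Definition toC (R : realType) (xy : R * R) : R[i]^o := xy.1 +i* xy.2.

Definition disc_int (R : realType) (g : R[i]^o -> R) : \bar R :=
  (\int[dA R]_(xy in @toC R @^-1` @unit_disc R) (g (toC xy))%:E)%E.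

(* Weights are represented by functions on the whole plane, of which only the
   values in the disc matter. *)
Definition weight (R : realType) (omega : R[i]^o -> R) : Prop :=
  (forall z, unit_disc z -> 0 < omega z) /\
  (dA R).-integrable (@toC R @^-1` @unit_disc R)
    (fun xy => (omega (toC xy))%:E).

Definition radial (R : realType) (omega : R[i]^o -> R) : Prop :=
  forall z, unit_disc z -> omega z = omega (cabs z)%:C.

Definition rapidly_increasing (R : realType) (omega : R[i]^o -> R) : Prop :=
  [/\ weight omega,
      radial omega,
      {within @unit_disc R, continuous omega} &
      (((omega r%:C * (1 - r))^-1)%R%:E *
         \int[lebesgue_measure]_(s in `[r, 1%R[) (omega s%:C)%:E)%E
        @[r --> 1^'-] --> +oo%E].

(* ||f||_{A^p_omega}^p, possibly +oo. *)
Definition bergman_normp (R : realType) (p : R) (omega : R[i]^o -> R)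
    (f : R[i]^o -> R[i]^o) : \bar R :=
  disc_int (fun z => cabs (f z) `^ p * omega z).

(* Lebesgue (not just Borel) measurability on [0,1): the sigma-algebra on the
   source is the completion of the Borel one. For such a phi the integrand
   below is Lebesgue measurable on R * R but perhaps not Borel; the library's
   integral of a nonnegative function is the supremum of the integrals of the
   Borel simple functions below it, which is then still its Lebesgue
   integral. *)
Definition lebesgue_measurable_on01 (R : realType) (phi : R -> R) : Prop :=
  measurable_fun
    (`[0, 1[%classic : set (g_sigma_algebraType
       (completed_algebra_gen (@lebesgue_measure R)))) phi.

(* \int_D |f'|^p phi(|z|)^p omega dA + |f(0)|^p *)
Definition derivative_normp (R : realType) (p : R) (omega : R[i]^o -> R)
    (phi : R -> R) (f : R[i]^o -> R[i]^o) : \bar R :=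
  (disc_int (fun z => (cabs (derive1 f z) `^ p * phi (cabs z) `^ p * omega z)%R)
     + (cabs (f 0%R) `^ p)%:E)%E.

(* Main.v *)
Require Import Defs.
From mathcomp Require Import all_boot all_order all_algebra.
From mathcomp Require Import all_classical all_reals all_analysis.
From mathcomp Require Import measurable_realfun.
From mathcomp Require Import ring lra.
Set Implicit Arguments.
Unset Strict Implicit.
Unset Printing Implicit Defensive.
Import Order.TTheory GRing.Theory Num.Theory.
Import numFieldNormedType.Exports.
Local Open Scope classical_set_scope.
Local Open Scope ring_scope.

(** Write L(t) = log (e / (1 - t)). The weight is
      omega(z) = 1 / ((1 - |z|^2) L(|z|^2)^(b + 1))   with b = max (1, p / 2),
    so that, in polar coordinates with t = |z|^2 and dL = dt / (1 - t), the
    integral of L^c omega over the disc is that of L^(c - b - 1) dL: it is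
    infinite for c = b and finite for c < b. Moreover the tail of omega beyond
    r, divided by omega(r) (1 - r), has the size of L(r^2), so omega is rapidly
    increasing.

    Suppose that the comparison holds for some phi. The monomials z^(2^k) show
    that the integrals of |z|^(p 2^k) omega and of
    (2^k |z|^(2^k - 1))^p phi^p omega are comparable, uniformly in k. Test it
    then on the sums f of the first N monomials with arbitrary signs, and
    average over the signs.
    - The average of |f|^2 is the sum of the |z|^(2^(k + 1)), which has the size
      of L(|z|^2) once N is large (dyadic_sum_le, dyadic_sum_ge). By Jensen, the
      average of |f|^p is at most (moment_signed_sum_le, p <= 2) or at least
      (moment_signed_sum_ge, p >= 2) the power p / 2 of that sum.
    - The terms 2^k |z|^(2^k - 1) of f' decay geometrically on both sides of the
      largest one (sum_dyadic_term_le). Up to constants, the sum of their powers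
      p thus bounds |f'|^p from above, by the triangle inequality, and its
      average from below, since changing the sign of the largest term changes
      f' by twice that term. By the comparison for monomials, integrating this sum against
      phi^p omega amounts to integrating the sum of the |z|^(p 2^k), whose size
      is again that of L(|z|^2), against omega.

    Hence the integral of L omega is controlled by that of L^(p / 2) omega if
    p < 2 (bound_p_le2), and conversely if p > 2 (bound_p_ge2). In both cases
    the controlled integral is infinite and the controlling one finite. All the
    test functions are polynomials; as the bounds are uniform in N, letting N
    tend to infinity gives the contradiction.

    The integrand containing phi need not be Borel. Its integral is then a lower
    integral, which is not additive in general; lower_envelope replaces
    phi^p omega by a Borel function without changing any of the integrals in
    which it occurs. *)

(** * Lacunary sums along the powers of two *)

Section DyadicTerms.
Context {R : realType}.
Implicit Types (p q r s t x y : R) (N k : nat).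

Lemma sum_geometric_increase (c : R) (b : nat -> R) n : 0 <= c -> (forall k, 0 <= b k) ->
  (forall k, (k < n)%N -> b k <= c * b k.+1) ->
  (1 - c) * \sum_(k < n.+1) b k <= b n.
Proof.
move=> c0 b0; elim: n => [|n ih] h.
  by rewrite big_ord_recl big_ord0 addr0; have := b0 0%N; nra.
rewrite big_ord_recr /= mulrDr.
have := ih (fun k kn => h k (ltnW kn)).
have := h n (ltnSn n); lra.
Qed.

Lemma sum_geometric_decrease (c : R) (b : nat -> R) n : 0 <= c -> (forall k, 0 <= b k) ->
  (forall k, b k.+1 <= c * b k) -> (1 - c) * \sum_(k < n) b k <= b 0%N.
Proof.
move=> c0 b0 h.
suff : (1 - c) * \sum_(k < n) b k <= b 0%N - b n by have := b0 n; lra.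
elim: n => [|n ih]; first by rewrite big_ord0; lra.
by rewrite big_ord_recr /= mulrDr; have := h n; lra.
Qed.

(** The modulus of the derivative of [z ^+ (2 ^ k)] on the circle of radius [r]. *)
Definition dyadic_term (r : R) k : R := 2 ^+ k * r ^+ (2 ^ k).-1.

Lemma dyadic_term_ge0 r k : 0 <= r -> 0 <= dyadic_term r k.
Proof. by move=> r0; rewrite mulr_ge0 ?exprn_ge0. Qed.

Lemma dyadic_termS r k : dyadic_term r k.+1 = (2 * r ^+ (2 ^ k)) * dyadic_term r k.
Proof.
rewrite /dyadic_term (_ : (2 ^ k.+1).-1 = (2 ^ k + (2 ^ k).-1)%N); last first.
  by rewrite expnS mul2n -addnn; have := expn_gt0 2 k; case: (2 ^ k)%N => //= n _; rewrite addnS.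
by rewrite exprS exprD; ring.
Qed.

(** The ratio of consecutive terms is [2 * r ^+ (2 ^ k)], which decreases in [k]
    and is squared and halved at each step. Take for [m] the first index at which
    it is at most [4 / 3]: before [m] the terms grow at least by the factor
    [4 / 3], and after [m.+1] they shrink at least by the factor [8 / 9], as
    [(4 / 3) ^+ 2 / 2 = 8 / 9]. *)
Lemma sum_dyadic_term_le p : 0 < p -> exists2 C, 0 < C & forall r N, 0 <= r < 1 ->
  (0 < N)%N -> exists2 m, (m < N)%N &
  \sum_(k < N) dyadic_term r k `^ p <= C * dyadic_term r m `^ p.
Proof.
move=> p0.
pose c1 : R := (3 / 4) `^ p; pose c2 : R := (8 / 9) `^ p.
have powR_lt1 (x : R) : 0 < x < 1 -> 0 <= x `^ p < 1.
  move=> /andP[x0 x1]; rewrite powR_ge0/=.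
  have := @gt0_ltr_powR R p p0 x 1; rewrite !nnegrE (ltW x0) ler01 powR1.
  by move=> /(_ isT isT); apply.
have /andP[c10 c11] : 0 <= c1 < 1 by apply: powR_lt1; lra.
have /andP[c20 c21] : 0 <= c2 < 1 by apply: powR_lt1; lra.
have two0 : 0 < (2 : R) `^ p by rewrite powR_gt0.
exists ((1 - c1)^-1 + 2 `^ p * (1 - c2)^-1).
  by rewrite addr_gt0// ?mulr_gt0 ?invr_gt0//; lra.
move=> r N /andP[r0 r1] N0.
pose b k := dyadic_term r k `^ p.
have b0 k : 0 <= b k by exact: powR_ge0.
pose P n := 2 * r ^+ (2 ^ n) <= 4 / 3.
have Pdec n n' : (n <= n')%N -> r ^+ (2 ^ n') <= r ^+ (2 ^ n).
  by move=> nn; apply: ler_wiXn2l; rewrite ?(ltW r1)//= leq_exp2l.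
have b_le (c : R) j k : 0 <= c -> dyadic_term r j <= c * dyadic_term r k -> b j <= c `^ p * b k.
  move=> cge h; rewrite /b -powRM//; last exact: dyadic_term_ge0.
  apply: (ge0_ler_powR (ltW p0)) => //; rewrite nnegrE; first exact: dyadic_term_ge0.
  by apply: mulr_ge0 => //; exact: dyadic_term_ge0.
have up m : (forall k, (k < m)%N -> ~~ P k) -> (1 - c1) * \sum_(k < m.+1) b k <= b m.
  move=> h; apply: sum_geometric_increase => // k /h; rewrite /P -ltNge => hk.
  apply: b_le; first lra.
  by rewrite dyadic_termS mulrA ler_peMl ?dyadic_term_ge0//; lra.
have inv1 : (1 - c1)^-1 > 0 by rewrite invr_gt0; lra.
have inv2 : (1 - c2)^-1 > 0 by rewrite invr_gt0; lra.
(* If the ratio stays above 4/3, the largest term is the last one. *)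
have [[m mN Pm]|noP] := pselect (exists2 m, (m < N)%N & P m); last first.
  exists N.-1; first by rewrite prednK.
  have : (1 - c1) * \sum_(k < N) b k <= b N.-1.
    rewrite -[in X in X <= _](prednK N0); apply: up => k kN.
    apply/negP => Pk; apply: noP; exists k => //.
    by rewrite (leq_trans kN)// leq_pred.
  rewrite -ler_pdivlMl; last lra.
  move/le_trans; apply; rewrite ler_wpM2r// ler_wpDr// mulr_ge0 ?ltW//.
have exP : exists m, (m < N)%N && P m by exists m; rewrite mN.
have [{mN Pm}m /andP[mN Pm] mmin] := ex_minnP exP.
exists m => //.
have upm : (1 - c1) * \sum_(k < m.+1) b k <= b m.
  apply: up => k km; apply/negP => Pk; have := mmin k.
  by rewrite Pk andbT (ltn_trans km mN) => /(_ isT); rewrite leqNgt km.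
have dn : (1 - c2) * \sum_(k < N - m.+1) b (m.+1 + k)%N <= b m.+1.
  have := @sum_geometric_decrease c2 (fun k => b (m.+1 + k)%N) (N - m.+1) c20 (fun=> b0 _).
  rewrite addn0; apply => k; rewrite addnS.
  apply: b_le; first lra.
  rewrite dyadic_termS ler_wpM2r ?dyadic_term_ge0//.
  have /Pdec h1 : (m.+1 <= m.+1 + k)%N by rewrite leq_addr.
  rewrite (le_trans (ler_wpM2l _ h1))//.
  rewrite expnS mulnC exprM; move: Pm; rewrite /P => Pm.
  have : 0 <= r ^+ (2 ^ m) by rewrite exprn_ge0.
  by rewrite expr2; nra.
have b1 : b m.+1 <= 2 `^ p * b m.
  apply: b_le => //.
  rewrite dyadic_termS ler_wpM2r ?dyadic_term_ge0//.
  by rewrite ger_pMr// exprn_ile1// ltW.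
have -> : \sum_(k < N) dyadic_term r k `^ p =
    \sum_(k < m.+1) b k + \sum_(k < N - m.+1) b (m.+1 + k)%N.
  rewrite -[in LHS](subnKC mN) big_split_ord/=; congr (_ + _).
move: upm dn; rewrite -ler_pdivlMl; last lra.
rewrite -(ler_pdivlMl _ _ (_ : 0 < 1 - c2)); last lra.
move=> h1 h2; rewrite mulrDl; apply: lerD => //.
by rewrite (le_trans h2)// [2 `^ p * _]mulrC -mulrA ler_wpM2l// ltW.
Qed.

End DyadicTerms.

Section DyadicSums.
Context {R : realType}.
Implicit Types (q t : R) (N k : nat).

Definition dyadic_sum N t : R := \sum_(k < N) t ^+ (2 ^ k).

(** The function log (e / (1 - t)). *)
Definition logf t : R := 1 - ln (1 - t).

Lemma dyadic_sum_ge0 N t : 0 <= t -> 0 <= dyadic_sum N t.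
Proof. by move=> t0; apply: sumr_ge0 => k _; rewrite exprn_ge0. Qed.

Lemma logf_ge1 t : 0 <= t < 1 -> 1 <= logf t.
Proof.
move=> /andP[t0 t1]; have := @ln_le0 R (1 - t); rewrite /logf => h.
have : ln (1 - t) <= 0 by apply: h; lra.
lra.
Qed.

Lemma ler_bernoulli (x : R) n : -1 <= x -> 1 + n%:R * x <= (1 + x) ^+ n.
Proof.
move=> x1; elim: n => [|n ih]; first by rewrite expr0; lra.
rewrite exprS -natr1; apply: (@le_trans _ _ ((1 + x) * (1 + n%:R * x))).
  have : 0 <= n%:R * (x * x) by rewrite mulr_ge0// -expr2 sqr_ge0.
  lra.
by rewrite ler_wpM2l//; lra.
Qed.

(** With [s = 1 - t] and [x k = (2 ^+ k * s)^-1], Bernoulli gives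
    [t ^+ (2 ^ k) <= x k / (1 + x k)]; since [x k.+1 = x k / 2], this is at most
    twice [ln (1 + x k) - ln (1 + x k.+1)], and the sum telescopes. *)
Lemma dyadic_sum_le N t : 0 <= t < 1 -> dyadic_sum N t <= 2 * logf t.
Proof.
move=> /andP[t0 t1]; pose s := 1 - t.
have s0 : 0 < s by rewrite /s; lra.
pose x k : R := (2 ^+ k * s)^-1.
have x0 k : 0 < x k by rewrite invr_gt0 mulr_gt0// exprn_gt0.
have xS k : x k.+1 = x k / 2 by rewrite /x exprS -mulrA invfM mulrC.
have step k : t ^+ (2 ^ k) <= 2 * (ln (1 + x k) - ln (1 + x k.+1)).
  have y0 := x0 k; have y1 := x0 k.+1.
  have le1 : t ^+ (2 ^ k) <= x k / (1 + x k).
    have -> : x k / (1 + x k) = (1 + 2 ^+ k * s)^-1.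
      have u0 : 0 < 2 ^+ k * s by rewrite mulr_gt0// exprn_gt0.
      rewrite /x; move: (2 ^+ k * s) u0 => u u0.
      by field; rewrite !gt_eqF ?addr_gt0.
    have d0 : 0 < 1 + 2 ^+ k * s by rewrite addr_gt0// mulr_gt0// exprn_gt0.
    rewrite -[leRHS]mul1r ler_pdivlMr//.
    have := @ler_bernoulli s (2 ^ k); rewrite natrX => h.
    apply: (@le_trans _ _ (t ^+ (2 ^ k) * (1 + s) ^+ (2 ^ k))).
      by rewrite ler_wpM2l ?exprn_ge0//; apply: h; lra.
    by rewrite -exprMn exprn_ile1//; rewrite /s; nra.
  apply: (le_trans le1).
  rewrite -ln_div ?posrE ?addr_gt0//.
  rewrite -[ln _]opprK -lnV ?posrE ?divr_gt0 ?addr_gt0// invf_div.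
  have e : (1 + x k.+1) / (1 + x k) = 1 + (- (x k / (1 + x k) / 2)).
    by rewrite xS; field; rewrite gt_eqF ?addr_gt0.
  have l1 : x k / (1 + x k) < 1 by rewrite ltr_pdivrMr ?addr_gt0//; lra.
  have := @le_ln1Dx R (- (x k / (1 + x k) / 2)); rewrite -e.
  move=> /(_ _)h; have {}h : ln ((1 + x k.+1) / (1 + x k)) <= - (x k / (1 + x k) / 2).
    by apply: h; lra.
  lra.
have tele : dyadic_sum N t <= 2 * (ln (1 + x 0%N) - ln (1 + x N)).
  rewrite /dyadic_sum; elim: N => [|N ih]; first by rewrite big_ord0 subrr mulr0.
  by rewrite big_ord_recr /=; have := step N; lra.
have lN : 0 <= ln (1 + x N) by rewrite ln_ge0// lerDl ltW.
apply: (le_trans tele); rewrite ler_wpM2l//.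
suff h : ln (1 + x 0%N) <= logf t by lra.
have -> : 1 + x 0%N = (1 + s) / s.
  by rewrite /x expr0 mul1r mulrDl divff ?gt_eqF// mul1r addrC.
rewrite ln_div ?posrE//; last lra.
rewrite /logf -/s.
have s1 : s <= 1 by rewrite /s; lra.
have : ln (1 + s) <= s by apply: le_ln1Dx; lra.
lra.
Qed.

(** By Bernoulli, each [k] with [2 ^+ k * (1 - t) < 1 / 2] contributes at
    least [1 / 2], and the number of such [k] has the size of the logarithm of
    [1 / (1 - t)]; the hypothesis says that all of them are summed. *)
Lemma dyadic_sum_ge N t : 0 <= t < 1 -> 1 <= 2 ^+ N.+1 * (1 - t) ->
  logf t / 2 - 1 <= dyadic_sum N t.
Proof.
move=> /andP[t0 t1]; pose s := 1 - t.
have s0 : 0 < s by rewrite /s; lra.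
have -> : logf t / 2 - 1 = (- ln s - 1) / 2 by rewrite /logf -/s; lra.
have ln2 : ln (2 : R) <= 1 by have := @le_ln1Dx R 1; lra.
(* Induction on N: the last term matters only if all terms are at least 1/2. *)
rewrite -/s; elim: N => [|N ih] hN.
  rewrite /dyadic_sum big_ord0.
  have : ln (2 * s) >= 0 by rewrite ln_ge0//; rewrite expr1 in hN.
  by rewrite lnM ?posrE//; lra.
have [/ih h|h] := leP 1 (2 ^+ N.+1 * s).
  by rewrite /dyadic_sum big_ord_recr /= (le_trans h)// lerDl exprn_ge0.
have lns : - ln s <= N.+2%:R.
  have : ln (2 ^+ N.+2 * s) >= 0 by rewrite ln_ge0.
  rewrite lnM ?posrE ?exprn_gt0// lnXn// -[ln _ *+ _]mulr_natl => h2.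
  have h3 : N.+2%:R * ln (2 : R) <= N.+2%:R by rewrite ler_piMr.
  by apply: le_trans h3; rewrite lerNl -subr_ge0 opprK addrC.
have : N.+1%:R / 2 <= dyadic_sum N.+1 t.
  have -> : N.+1%:R / 2 = \sum_(k < N.+1) (2^-1 : R).
    by rewrite sumr_const card_ord mulr_natl.
  apply: ler_sum => k _.
  have := @ler_bernoulli (- s) (2 ^ k); rewrite (_ : 1 - s = t); last by rewrite /s; lra.
  move=> hb; apply: le_trans (hb _); last by rewrite /s; lra.
  have : 2 ^+ k.+1 * s <= 2 ^+ N.+1 * s.
    apply: ler_wpM2r; first exact: ltW.
    by rewrite ler_weXn2l ?ler1n.
  by rewrite natrX exprS; lra.
by rewrite -natr1 in lns; lra.
Qed.

End DyadicSums.

(** * Averages over random signs *)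

Section TangentLines.
Context {R : realType}.
Implicit Types q y : R.

Lemma powR_le_tangent q y : 0 < q <= 1 -> 0 <= y -> y `^ q <= q * y + (1 - q).
Proof.
move=> /andP[q0 q1] y0; have [->|q1'] := eqVneq q 1.
  by rewrite powRr1// mul1r subrr addr0.
have ql1 : q < 1 by rewrite lt_neqAle q1' q1.
have h := @conjugate_powR R (y `^ q) 1 q^-1 (1 - q)^-1.
have {h} := h (powR_ge0 _ _) ler01.
rewrite !invr_gt0 q0 subr_gt0 ql1 !invrK mulr1 -powRrM divff ?gt_eqF// powRr1//.
rewrite powR1 mul1r mulrC; apply => //; lra.
Qed.

Lemma powR_ge_tangent q y : 1 <= q -> 0 <= y -> q * y + (1 - q) <= y `^ q.
Proof.
move=> q1 y0; have q0 : 0 < q by lra.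
have := @powR_le_tangent q^-1 (y `^ q).
rewrite invr_gt0 q0 invf_le1// q1 powR_ge0 -powRrM divff ?gt_eqF// powRr1//.
move=> /(_ isT isT); rewrite -(ler_pM2l q0) mulrDr mulrA divff ?gt_eqF// mul1r.
by rewrite mulrBr mulr1 divff ?gt_eqF//; lra.
Qed.

End TangentLines.

Section RandomSigns.
Context {R : realType}.
Variable N : nat.
Implicit Types (e : {ffun 'I_N -> bool}) (k : 'I_N).

Definition flip k e : {ffun 'I_N -> bool} := [ffun j => e j (+) (j == k)].

Lemma flipK k : involutive (flip k).
Proof. by move=> e; apply/ffunP => j; rewrite !ffunE addbK. Qed.

Lemma sum_flip (V : nmodType) k (F : {ffun 'I_N -> bool} -> V) :
  \sum_e F (flip k e) = \sum_e F e.
Proof. by rewrite [RHS](reindex_inj (inv_inj (flipK k))). Qed.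

(** The cross terms of the square cancel in pairs of sign vectors differing in a
    single coordinate. *)
Lemma sum_signs_sqr (x : 'I_N -> R) :
  \sum_(e : {ffun 'I_N -> bool}) (\sum_k (-1) ^+ e k * x k) ^+ 2 = (2 ^ N)%:R * \sum_k x k ^+ 2.
Proof.
have cross j k : j != k ->
    \sum_(e : {ffun 'I_N -> bool}) ((-1) ^+ e j * x j) * ((-1) ^+ e k * x k) = 0 :> R.
  move=> jk; set S := LHS; suff : S = - S by lra.
  rewrite {1}/S -(sum_flip j) -sumrN; apply: eq_bigr => e _.
  by rewrite !ffunE eqxx [k == j]eq_sym (negbTE jk) addbF addbT signrN mulNr mulNr.
under eq_bigr do rewrite expr2 big_distrlr /=.
rewrite exchange_big /= mulr_sumr; apply: eq_bigr => j _.
rewrite exchange_big /= (bigD1 j)//= [X in _ + X]big1 ?addr0; last first.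
  by move=> k kj; rewrite cross// eq_sym.
under eq_bigr do rewrite mulrACA -expr2 sqrr_sign mul1r -expr2.
by rewrite sumr_const card_ffun card_bool card_ord mulr_natl.
Qed.

End RandomSigns.

Section RandomComplexSums.
Context {R : realType}.
Implicit Types (z : R[i]^o) (p : R).

Lemma cabs_ge0 z : 0 <= cabs z.
Proof. by case: z => a b; exact: sqrtr_ge0. Qed.

Lemma cabs_sqr z : cabs z ^+ 2 = complex.Re z ^+ 2 + complex.Im z ^+ 2.
Proof. by case: z => a b; rewrite /cabs /= sqr_sqrtr// addr_ge0 ?sqr_ge0. Qed.

Lemma cabsM (z w : R[i]) : cabs (z * w) = cabs z * cabs w.
Proof. exact: ComplexField.Normc.normcM. Qed.

Lemma cabsX (z : R[i]) n : cabs (z ^+ n) = cabs z ^+ n.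
Proof.
elim: n => [|n ih]; last by rewrite !exprS cabsM ih.
by rewrite !expr0; exact: ComplexField.Normc.normc1.
Qed.

Lemma cabsD z w : cabs (z + w) <= cabs z + cabs w.
Proof. exact: le_normcD. Qed.

Lemma cabsN z : cabs (- z) = cabs z.
Proof. exact: normcN. Qed.

Lemma cabs_sign (b : bool) : cabs ((-1) ^+ b : R[i]) = 1.
Proof.
have c1 : cabs (1 : R[i]^o) = 1 by exact: ComplexField.Normc.normc1.
by case: b; rewrite ?expr1 ?expr0 ?cabsN.
Qed.

Lemma cabs_nat n : cabs (n%:R : R[i]) = n%:R.
Proof.
have -> : (n%:R : R[i]) = ((n%:R : R)%:C)%C by rewrite rmorph_nat.
by rewrite /cabs /= expr0n/= addr0 sqrtr_sqr ger0_norm.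
Qed.

Lemma cabs_sum N (a : 'I_N -> R[i]^o) :
  cabs (\sum_k a k) <= \sum_k cabs (a k).
Proof.
elim/big_ind2 : _ => //; last by move=> *; rewrite (le_trans (cabsD _ _))// lerD.
by have -> : cabs 0 = 0 :> R by exact: ComplexField.Normc.normc0.
Qed.

Variable N : nat.
Implicit Types (e : {ffun 'I_N -> bool}) (a : 'I_N -> R[i]).

Definition signed_sum a e : R[i] := \sum_k (-1) ^+ e k * a k.

Lemma Re_signed_sum a e :
  complex.Re (signed_sum a e) = \sum_k (-1) ^+ e k * complex.Re (a k).
Proof.
rewrite /signed_sum raddf_sum; apply: eq_bigr => k _.
by case: (e k) => /=; rewrite ?expr1 ?expr0 ?mul1r// !mulN1r raddfN.
Qed.

Lemma Im_signed_sum a e :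
  complex.Im (signed_sum a e) = \sum_k (-1) ^+ e k * complex.Im (a k).
Proof.
rewrite /signed_sum raddf_sum; apply: eq_bigr => k _.
by case: (e k) => /=; rewrite ?expr1 ?expr0 ?mul1r// !mulN1r raddfN.
Qed.

Lemma sum_signed_sum_sqr a :
  \sum_e cabs (signed_sum a e) ^+ 2 = (2 ^ N)%:R * \sum_k cabs (a k) ^+ 2.
Proof.
under eq_bigr do rewrite cabs_sqr Re_signed_sum Im_signed_sum.
rewrite big_split /= !sum_signs_sqr -mulrDr -big_split /=.
by congr (_ * _); apply: eq_bigr => k _; rewrite cabs_sqr.
Qed.

Lemma sum_signs_cst (c : R) : \sum_(e : {ffun 'I_N -> bool}) c = (2 ^ N)%:R * c.
Proof. by rewrite sumr_const card_ffun card_bool card_ord mulr_natl. Qed.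

Lemma powR_half_sqr p (x : R) : 0 <= x -> x `^ p = (x ^+ 2) `^ (p / 2).
Proof. by move=> x0; rewrite -powR_mulrn// -powRrM mulrC divfK. Qed.

(** Jensen's inequality for the exponent [p / 2] is obtained by averaging the
    tangent line of the power function at the mean square [S]; this is the value
    of that average. *)
Lemma sum_signed_sum_linear p a (S := \sum_k cabs (a k) ^+ 2) : 0 < S ->
  \sum_e S `^ (p / 2) * (p / 2 * (cabs (signed_sum a e) ^+ 2 / S) + (1 - p / 2))
  = (2 ^ N)%:R * S `^ (p / 2).
Proof.
move=> S0; rewrite -mulr_sumr big_split/= -mulr_sumr -mulr_suml.
rewrite sum_signed_sum_sqr sum_signs_cst -/S mulfK ?gt_eqF//; ring.
Qed.

Lemma powR_split p (S x : R) : 0 < S -> 0 <= x ->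
  x `^ p = S `^ (p / 2) * (x ^+ 2 / S) `^ (p / 2).
Proof.
move=> S0 x0; rewrite -powRM ?(ltW S0) ?divr_ge0 ?sqr_ge0 ?(ltW S0)//.
by rewrite mulrC divfK ?gt_eqF// powR_half_sqr.
Qed.

Lemma signed_sum_eq0 a e : \sum_k cabs (a k) ^+ 2 = 0 ->
  cabs (signed_sum a e) = 0.
Proof.
move=> S0; have := sum_signed_sum_sqr a; rewrite S0 mulr0 => h.
apply/eqP; rewrite -sqrf_eq0; apply/eqP.
by apply: (psumr_eq0P _ h) => // i _; exact: sqr_ge0.
Qed.

Lemma moment_signed_sum_le p a : 0 < p <= 2 ->
  \sum_e cabs (signed_sum a e) `^ p
    <= (2 ^ N)%:R * (\sum_k cabs (a k) ^+ 2) `^ (p / 2).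
Proof.
move=> /andP[p0 p2]; have : 0 <= \sum_k cabs (a k) ^+ 2.
  by apply: sumr_ge0 => k _; exact: sqr_ge0.
rewrite le_eqVlt => /predU1P[S0|S0].
  rewrite -S0 big1 => [|e _]; first by rewrite mulr_ge0// powR_ge0.
  by rewrite signed_sum_eq0// powR0// gt_eqF.
rewrite -sum_signed_sum_linear//; apply: ler_sum => e _.
rewrite (powR_split p S0 (cabs_ge0 _)) ler_wpM2l ?powR_ge0//.
by apply: powR_le_tangent; [lra|rewrite divr_ge0 ?sqr_ge0// ltW].
Qed.

Lemma moment_signed_sum_ge p a : 2 <= p ->
  (2 ^ N)%:R * (\sum_k cabs (a k) ^+ 2) `^ (p / 2)
    <= \sum_e cabs (signed_sum a e) `^ p.
Proof.
move=> p2; have : 0 <= \sum_k cabs (a k) ^+ 2.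
  by apply: sumr_ge0 => k _; exact: sqr_ge0.
rewrite le_eqVlt => /predU1P[S0|S0].
  rewrite -S0 powR0 ?mulr0; last by rewrite gt_eqF//; lra.
  by apply: sumr_ge0 => e _; exact: powR_ge0.
rewrite -sum_signed_sum_linear//; apply: ler_sum => e _.
rewrite (powR_split p S0 (cabs_ge0 _)) ler_wpM2l ?powR_ge0//.
by apply: powR_ge_tangent; [lra|rewrite divr_ge0 ?sqr_ge0// ltW].
Qed.

Lemma signed_sum_flip a e k :
  signed_sum a (flip k e) = signed_sum a e - 2 * ((-1) ^+ e k * a k).
Proof.
rewrite /signed_sum (bigD1 k)//= [in RHS](bigD1 k)//= ffunE eqxx addbT signrN.
rewrite (eq_bigr (fun j => (-1) ^+ e j * a j)); first by ring.
by move=> j jk; rewrite ffunE (negbTE jk) addbF.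
Qed.

(** Of two signed sums differing only in the sign of [a k], one has modulus at
    least [cabs (a k)]. *)
Lemma moment_signed_sum_ge_term p a k : 0 < p ->
  (2 ^ N)%:R * cabs (a k) `^ p <= 2 * \sum_e cabs (signed_sum a e) `^ p.
Proof.
move=> p0; rewrite [leRHS]mulr_natl mulr2n -[X in X + _](sum_flip k) -big_split/=.
rewrite -sum_signs_cst; apply: ler_sum => e _.
set u := signed_sum a (flip k e); set v := signed_sum a e.
have uv : 2 * cabs (a k) <= cabs u + cabs v.
  have <- : cabs (v - u) = 2 * cabs (a k).
    rewrite /u signed_sum_flip opprB addrCA subrr addr0.
    by rewrite !cabsM cabs_sign mul1r cabs_nat.
  by rewrite (le_trans (cabsD _ _))// cabsN addrC.
have mono (x y : R) : 0 <= x -> x <= y -> x `^ p <= y `^ p.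
  move=> x0 xy; apply: (ge0_ler_powR (ltW p0)) => //.
  by rewrite nnegrE (le_trans x0).
have [h|h] := leP (cabs u) (cabs v).
  rewrite -[leLHS]add0r lerD ?powR_ge0// mono ?cabs_ge0//; lra.
rewrite -[leLHS]addr0 lerD ?powR_ge0// mono ?cabs_ge0//; lra.
Qed.

End RandomComplexSums.

(** * Integrals of nonmeasurable functions *)

Section LowerEnvelope.
Context d (T : measurableType d) (R : realType) (mu : {measure set T -> \bar R}).
Variable D : set T.
Hypothesis mD : measurable D.
Implicit Types f g u v : T -> R.

Import HBNNSimple.

Local Open Scope ereal_scope.

(** The integral of a nonnegative function is a supremum over simple functions,
    hence monotone without any measurability. *)
Lemma le_lower_integral (f1 f2 : T -> \bar R) :
  (forall x, D x -> 0 <= f1 x) -> (forall x, D x -> f1 x <= f2 x) ->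
  \int[mu]_(x in D) f1 x <= \int[mu]_(x in D) f2 x.
Proof.
move=> f10 f12; rewrite !ge0_integralE//; last first.
  by move=> x Dx; rewrite (le_trans _ (f12 x Dx))// f10.
apply: ereal_sup_le => _ [h /= hf <-]; exists h => // x.
rewrite (le_trans (hf x))// /patch; case: ifPn => //; rewrite inE.
exact: f12.
Qed.

Lemma lower_integral_gt f (M : \bar R) : (forall x, D x -> (0 <= f x)%R) ->
  M < \int[mu]_(x in D) (f x)%:E ->
  exists v : T -> R, [/\ measurable_fun D v, (forall x, D x -> (0 <= v x <= f x)%R) &
    M < \int[mu]_(x in D) (v x)%:E].
Proof.
move=> f0; rewrite ge0_integralE; last by move=> x Dx; rewrite lee_fin f0.
move=> /ereal_sup_gt[_ [h /= hf <-] Mh]; exists h; split.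
- exact: measurable_funTS.
- move=> x Dx; rewrite fun_ge0/=; have := hf x.
  by rewrite patchE mem_set// lee_fin.
- rewrite integral_nnsfun//.
  rewrite (_ : h \_ D = h)//; apply/funext => x; rewrite patchE.
  case: ifPn => //; rewrite notin_setE => Dx; have := hf x.
  rewrite patchE memNset// lee_fin => hx.
  by apply/eqP; rewrite eq_le hx fun_ge0.
Qed.

Lemma lower_integral_le f (M : \bar R) : (forall x, D x -> (0 <= f x)%R) ->
  (forall v, measurable_fun D v -> (forall x, D x -> (0 <= v x <= f x)%R) ->
    \int[mu]_(x in D) (v x)%:E <= M) -> \int[mu]_(x in D) (f x)%:E <= M.
Proof.
move=> f0 h; rewrite leNgt; apply/negP => /(lower_integral_gt f0)[v [mv vf]].
by rewrite ltNge h.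
Qed.

(** The pointwise supremum of a sequence of measurable minorants whose integrals
    tend to the lower integral. *)
Lemma lower_envelope_exists g : (forall x, D x -> (0 <= g x)%R) ->
  \int[mu]_(x in D) (g x)%:E < +oo ->
  exists h : T -> R, [/\ measurable_fun D h, (forall x, D x -> (0 <= h x <= g x)%R) &
    \int[mu]_(x in D) (h x)%:E = \int[mu]_(x in D) (g x)%:E].
Proof.
move=> g0 Ioo; set I := \int[mu]_(x in D) (g x)%:E in Ioo *.
have I0 : 0 <= I by apply: integral_ge0 => x Dx; rewrite lee_fin g0.
have Ifin : I \is a fin_num by rewrite ge0_fin_numE.
have ex n : exists v, [/\ measurable_fun D v,
    (forall x, D x -> (0 <= v x <= g x)%R) &
    I - n.+1%:R^-1%:E < \int[mu]_(x in D) (v x)%:E].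
  apply: lower_integral_gt => //; rewrite lteBlDr// lteDl//.
pose v n := sval (cid (ex n)).
have vP n : [/\ measurable_fun D (v n),
    (forall x, D x -> (0 <= v n x <= g x)%R) &
    I - n.+1%:R^-1%:E < \int[mu]_(x in D) (v n x)%:E].
  exact: (svalP (cid (ex n))).
have ub x : D x -> has_ubound (range (v ^~ x)).
  move=> Dx; exists (g x) => _ [n _ <-].
  by have [_ /(_ x Dx)/andP[]] := vP n.
pose h x := sups (v ^~ x) 0%N.
have vh n x : D x -> (v n x <= h x)%R.
  move=> Dx; rewrite /h /sups /= ub_le_sup//; last by exists n.
  by have [M MP] := ub x Dx; exists M => _ [k _ <-]; apply: MP; exists k.
have hg x : D x -> (h x <= g x)%R.
  move=> Dx; rewrite /h /sups /=; apply: ge_sup; first by exists (v 0%N x), 0%N.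
  by move=> _ [k _ <-]; have [_ /(_ x Dx)/andP[]] := vP k.
have mh : measurable_fun D h.
  by apply: measurable_fun_sups => // n; have [] := vP n.
have h0 x : D x -> (0 <= h x)%R.
  by move=> Dx; rewrite (le_trans _ (vh 0%N x Dx))//; have [_ /(_ x Dx)/andP[]] := vP 0%N.
exists h; split => //.
  by move=> x Dx; rewrite h0// hg.
apply/eqP; rewrite eq_le; apply/andP; split.
  by apply: le_lower_integral => x Dx; rewrite lee_fin ?h0 ?hg.
apply/lee_addgt0Pr => e e0.
pose n := Num.truncn (e^-1).
have ne : (n.+1%:R^-1 <= e)%R.
  rewrite invf_ple ?posrE//.
  exact/ltW/truncnS_gt.
rewrite -leeBlDr//; have [_ _ /ltW In] := vP n.
have hv : \int[mu]_(x in D) (v n x)%:E <= \int[mu]_(x in D) (h x)%:E.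
  apply: le_lower_integral => x Dx; rewrite lee_fin ?vh//.
  by have [_ /(_ x Dx)/andP[]] := vP n.
apply: le_trans hv; apply: le_trans In.
by rewrite leeD2l// leeN2 lee_fin.
Qed.

(** If [h] is a measurable minorant of [g] with the same integral, then for a
    measurable [v] below [u * g] the function [Num.max (v / u) h] is another
    minorant, so it equals [h] almost everywhere, and [v <= u * h] almost
    everywhere. *)
Lemma lower_envelope g : (forall x, D x -> (0 <= g x)%R) ->
  \int[mu]_(x in D) (g x)%:E < +oo ->
  exists h : T -> R, [/\ measurable_fun D h, (forall x, D x -> (0 <= h x)%R) &
    forall u, measurable_fun D u -> (forall x, D x -> (0 <= u x)%R) ->
    \int[mu]_(x in D) (u x * g x)%:E = \int[mu]_(x in D) (u x * h x)%:E].
Proof.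
move=> g0 Ioo; have [h [mh hg hI]] := lower_envelope_exists g0 Ioo.
have h0 x : D x -> (0 <= h x)%R by move=> /hg/andP[].
exists h; split => // u mu_ u0.
apply/eqP; rewrite eq_le; apply/andP; split; last first.
  apply: le_lower_integral => x Dx; rewrite lee_fin ?mulr_ge0 ?u0 ?h0//.
  by apply: ler_wpM2l; [exact: u0|case/andP: (hg x Dx)].
apply: lower_integral_le => [x Dx|v mv vug]; first by rewrite mulr_ge0 ?u0 ?g0.
(* The inverse as a power is measurable, and vanishes where u does. *)
pose m x := Num.max (v x * u x `^ (-1))%R (h x).
have mm : measurable_fun D m.
  apply: measurable_maxr => //; apply: measurable_funM => //.
  exact: (measurableT_comp (@measurable_powR R (-1)) mu_).
have hm x : (h x <= m x)%R by rewrite /m le_max lexx orbT.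
have mg x : D x -> (m x <= g x)%R.
  move=> Dx; rewrite /m ge_max; case/andP: (hg x Dx) => _ ->; rewrite andbT.
  rewrite powR_inv1 ?u0//; have := u0 x Dx.
  rewrite le_eqVlt => /predU1P[<-|ux]; first by rewrite invr0 mulr0 g0.
  by rewrite ler_pdivrMr// mulrC; case/andP: (vug x Dx).
have vum x : D x -> (v x <= u x * m x)%R.
  move=> Dx; have := u0 x Dx; rewrite le_eqVlt => /predU1P[ux|ux].
    by have := vug x Dx; rewrite -ux !mul0r => /andP[].
  rewrite -ler_pdivrMl// mulrC /m le_max -powR_inv1 ?lexx// ltW//.
have mmh : measurable_fun D (m \- h)%R by exact: measurable_funB.
have mh0 x : (0 <= m x - h x)%R by rewrite subr_ge0.
have diff0 : \int[mu]_(x in D) (m x - h x)%:E = 0.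
  have : \int[mu]_(x in D) (m x)%:E <= \int[mu]_(x in D) (h x)%:E.
    rewrite hI; apply: le_lower_integral => x Dx; rewrite lee_fin ?mg//.
    by rewrite (le_trans (h0 x Dx)).
  have -> : \int[mu]_(x in D) (m x)%:E =
      \int[mu]_(x in D) (h x)%:E + \int[mu]_(x in D) (m x - h x)%:E.
    rewrite -ge0_integralD//=.
    - by apply: eq_integral => x _; rewrite -EFinD addrC subrK.
    - exact/measurable_EFinP.
    - by move=> x _; rewrite lee_fin.
    - exact/measurable_EFinP.
  have hfin : \int[mu]_(x in D) (h x)%:E \is a fin_num.
    by rewrite hI ge0_fin_numE//; apply: integral_ge0 => x Dx; rewrite lee_fin g0.
  rewrite -[leRHS]adde0 leeD2lE// => le0.
  apply/eqP; rewrite eq_le le0 /=.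
  by apply: integral_ge0 => x _; rewrite lee_fin.
have ae0 : ae_eq mu D (EFin \o (m \- h)%R) (cst 0).
  apply/ae_eq_integral_abs => //; first exact/measurable_EFinP.
  apply: etrans diff0; apply: eq_integral => x _.
  by rewrite /= ger0_norm.
have udiff0 : \int[mu]_(x in D) (u x * (m x - h x))%:E = 0.
  have mum : measurable_fun D (fun x => (u x * (m x - h x))%:E).
    apply/measurable_EFinP; exact: measurable_funM.
  have <- : \int[mu]_(x in D) `|(u x * (m x - h x))%:E| = \int[mu]_(x in D) (u x * (m x - h x))%:E.
    apply: eq_integral => x /[!inE] Dx.
    by rewrite /= ger0_norm// mulr_ge0// u0.
  apply/ae_eq_integral_abs => //.
  apply: filterS ae0 => x /= H Dx; have := H Dx => -[->].
  by rewrite mulr0.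
have -> : \int[mu]_(x in D) (u x * h x)%:E = \int[mu]_(x in D) (u x * m x)%:E.
  rewrite -[LHS]adde0 -udiff0 -ge0_integralD//.
  - by apply: eq_integral => x _; rewrite -EFinD -mulrDr addrC subrK.
  - by move=> x Dx; rewrite lee_fin mulr_ge0 ?u0 ?h0.
  - by apply/measurable_EFinP; exact: measurable_funM.
  - by move=> x Dx; rewrite lee_fin mulr_ge0 ?u0 ?h0.
  - by apply/measurable_EFinP; exact: measurable_funM.
apply: le_lower_integral => x Dx; rewrite lee_fin; last exact: vum.
by case/andP: (vug x Dx).
Qed.

End LowerEnvelope.

(** * Integration of radial functions *)

Section Scaling.
Context {R : realType}.
Local Notation lam := (@lebesgue_measure R).
Local Open Scope ereal_scope.

Lemma measurable_mulrl (c : R) : measurable_fun [set: measurableTypeR R]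
  (fun x : measurableTypeR R => (c * x)%R : measurableTypeR R).
Proof. by apply: measurable_funM => //; exact: measurable_cst. Qed.

Lemma lebesgue_measure_scale (c : R) (c0 : (0 < c)%R) (A : set (measurableTypeR R)) :
  measurable A ->
  lam A = c%:E * lam ((fun x : measurableTypeR R => (c * x)%R : measurableTypeR R) @^-1` A).
Proof.
move=> mA.
pose m : {measure set (measurableTypeR R) -> \bar R} :=
  mscale (NngNum (ltW c0))
   (measure_function_pushforward__canonical__measure_function_Measure lam (measurable_mulrl c)).
apply: (@lebesgue_measure_unique R m) => // _ [[a b]] _ <-.
rewrite /m /= /mscale /pushforward /=.
rewrite [X in _ = _ * lebesgue_measure X](_ : _ =
    `](c^-1 * a)%R, (c^-1 * b)%R]%classic); last first.
  apply/seteqP; split => x /=; rewrite !in_itv/=.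
    by rewrite ltr_pdivrMl// ler_pdivlMl.
  by rewrite ltr_pdivrMl// ler_pdivlMl.
rewrite !lebesgue_measure_itv/= !lte_fin ltr_pM2l ?invr_gt0//.
case: ifPn => _; last by rewrite mule0.
by rewrite -!EFinB -EFinM -mulrBr mulrA divff ?gt_eqF// mul1r.
Qed.

Lemma ge0_integral_scale (c : R) (c0 : (0 < c)%R) (f : R -> \bar R) :
  measurable_fun [set: R] f -> (forall x, 0 <= f x) ->
  \int[lam]_x f x = c%:E * \int[lam]_x f (c * x)%R.
Proof.
move=> mf f0.
have := @ge0_integral_pushforward _ _ _ _ _ _ (measurable_mulrl c) lam
  setT f measurableT mf (fun x _ => f0 x).
rewrite preimage_setT /= => <-.
pose m : {measure set (measurableTypeR R) -> \bar R} :=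
   (measure_function_pushforward__canonical__measure_function_Measure lam (measurable_mulrl c)).
have := @ge0_integral_mscale _ _ _ m setT measurableT (NngNum (ltW c0)) f mf (fun x _ => f0 x).
move=> /= <-.
by apply: eq_measure_integral => A mA _; exact: lebesgue_measure_scale.
Qed.

End Scaling.

Section RadialMeasure.
Context {R : realType}.
Local Notation lam := (@lebesgue_measure R).
Local Open Scope ereal_scope.

Definition sqn (xy : measurableTypeR R * measurableTypeR R) : measurableTypeR R :=
  (xy.1 ^+ 2 + xy.2 ^+ 2)%R.

Lemma measurable_sqn : measurable_fun setT sqn.
Proof.
by apply: measurable_funD; apply: measurable_funX;
  [exact: measurable_fst|exact: measurable_snd].
Qed.

Lemma measurable_sqn_preimage (A : set (measurableTypeR R)) :
  measurable A -> measurable (sqn @^-1` A).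
Proof. by move=> mA; rewrite -[X in measurable X]setTI; exact: measurable_sqn. Qed.

(** The area of the closed disc of radius [Num.sqrt t]. *)
Definition disc_area (t : R) : \bar R :=
  (lam \x lam) (sqn @^-1` `]-oo, t]%classic).

(** The formula covers negative [t - x ^+ 2], for which the chord is empty and
    the square root is zero. *)
Lemma disc_areaE t : disc_area t = \int[lam]_x (2 * Num.sqrt (t - x ^+ 2))%:E.
Proof.
rewrite /disc_area /product_measure1; apply: eq_integral => x _ /=.
have s0 := sqrtr_ge0 (t - x ^+ 2).
have [tx|tx] := leP 0%R (t - x ^+ 2)%R.
  have -> : xsection (sqn @^-1` `]-oo, t]) x =
     `[(- Num.sqrt (t - x ^+ 2))%R, (Num.sqrt (t - x ^+ 2))%R]%classic.
    apply/seteqP; split => y.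
      move/xsectionP; rewrite /= !in_itv/= /sqn/= => h.
      by rewrite -ler_norml -sqrtr_sqr ler_sqrt//; lra.
    rewrite /= !in_itv/= -ler_norml -sqrtr_sqr ler_sqrt// => h.
    by apply/xsectionP; rewrite /= in_itv/= /sqn/=; lra.
  rewrite lebesgue_measure_itv/= lte_fin.
  case: ifPn => [_|]; first by rewrite -EFinB; congr (_%:E); lra.
  by rewrite -leNgt => h; congr (_%:E); lra.
rewrite ltr0_sqrtr// mulr0 (_ : xsection _ _ = set0) ?measure0//.
apply/seteqP; split => y // /xsectionP; rewrite /= in_itv/= /sqn/= => h.
have := sqr_ge0 y; lra.
Qed.

Lemma measurable_chord t : measurable_fun [set: R] (fun x : R => (2 * Num.sqrt (t - x ^+ 2))%:E).
Proof.
apply/measurable_EFinP; apply: measurable_funM; first exact: measurable_cst.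
apply: measurableT_comp.
  by apply: continuous_measurable_fun; exact: sqrt_continuous.
by apply: measurable_funB; [exact: measurable_cst|exact: measurable_funX].
Qed.

Lemma disc_area_scale t : (0 <= t)%R -> disc_area t = t%:E * disc_area 1.
Proof.
rewrite le_eqVlt => /predU1P[<-|t0].
  rewrite mul0e disc_areaE; apply: integral0_eq => x _.
  by rewrite ler0_sqrtr ?mulr0// sub0r oppr_le0 sqr_ge0.
rewrite !disc_areaE.
have c0 : (0 < Num.sqrt t)%R by rewrite sqrtr_gt0.
rewrite (ge0_integral_scale c0 (measurable_chord t)); last first.
  by move=> x; rewrite lee_fin mulr_ge0// sqrtr_ge0.
have -> : t%:E = (Num.sqrt t)%:E * (Num.sqrt t)%:E.
  by rewrite -EFinM -expr2 sqr_sqrtr// ltW.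
rewrite -muleA; congr (_ * _).
rewrite -ge0_integralZl//; last exact: measurable_chord.
- by apply: eq_integral => x _; rewrite -EFinM; congr (_%:E);
    rewrite exprMn sqr_sqrtr ?(ltW t0)// -[X in (X - _)%R]mulr1 -mulrBr sqrtrM ?(ltW t0)//; ring.
Qed.

Lemma disc_area1 : exists2 a : R, (0 < a)%R & disc_area 1 = a%:E.
Proof.
(* The unit disc lies between the squares of sides 1 and 2. *)
have le4 : disc_area 1 <= 4%:E.
  apply: (@le_trans _ _ ((lam \x lam) (`[(-1)%R, 1%R] `*` `[(-1)%R, 1%R]))).
    apply: le_measure; rewrite ?inE.
    - exact: measurable_sqn_preimage.
    - by apply: measurableX.
    - move=> [x y]; rewrite /= /sqn !in_itv/= => h.
      have sq (w : R) : (w ^+ 2 <= 1)%R -> (-1 <= w <= 1)%R.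
        by move=> w1; rewrite -ler_norml -(@expr_le1 _ 2%N)// real_normK ?num_real.
      by have := sqr_ge0 x; have := sqr_ge0 y; split; apply: sq; lra.
  rewrite product_measure1E//= lebesgue_measure_itv/= lte_fin.
  by case: ifPn => _; rewrite -?EFinB -?EFinM lee_fin; lra.
have ge1 : 1 <= disc_area 1.
  apply: (@le_trans _ _ ((lam \x lam) (`[(-2^-1)%R, 2^-1%R] `*` `[(-2^-1)%R, 2^-1%R]))).
    rewrite product_measure1E//= lebesgue_measure_itv/= lte_fin.
    by case: ifPn => h; rewrite -?EFinB -?EFinM lee_fin; lra.
  apply: le_measure; rewrite ?inE.
  - by apply: measurableX.
  - exact: measurable_sqn_preimage.
  - move=> [x y]; rewrite /= /sqn !in_itv/= => -[/andP[x1 x2] /andP[y1 y2]].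
    have hx : (0 <= (x + 2^-1) * (2^-1 - x))%R by apply: mulr_ge0; lra.
    have hy : (0 <= (y + 2^-1) * (2^-1 - y))%R by apply: mulr_ge0; lra.
    by lra.
have f : disc_area 1 \is a fin_num.
  by rewrite ge0_fin_numE ?(le_lt_trans le4) ?ltry// (le_trans _ ge1).
exists (fine (disc_area 1)); last by rewrite fineK.
by rewrite -lte_fin fineK// (lt_le_trans _ ge1)// lte_fin.
Qed.

End RadialMeasure.

Section RadialIntegral.
Context {R : realType}.
Local Notation lam := (@lebesgue_measure R).
Local Open Scope ereal_scope.

(** The image of the area measure under [(x, y) |-> x ^+ 2 + y ^+ 2]. *)
Definition sqn_law : {measure set (measurableTypeR R) -> \bar R} :=
  measure_function_pushforward__canonical__measure_function_Measure (dA R)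
    (@measurable_sqn R).

Lemma sqn_law_itvNy : exists2 a : R, (0 < a)%R &
  forall t, sqn_law `]-oo, t]%classic = (a * Num.max t 0)%:E.
Proof.
have [a1 a10 a1E] := @disc_area1 R.
exists (pi^-1 * a1)%R; first by rewrite mulr_gt0// invr_gt0 pi_gt0.
have E t : sqn_law `]-oo, t]%classic = (pi^-1)%:E * disc_area t by [].
move=> t; rewrite E; have [t0|t0] := leP 0%R t.
  rewrite disc_area_scale// a1E -!EFinM; congr (_%:E).
  by rewrite mulrAC -mulrA [(t * _)%R]mulrC mulrA.
rewrite mulr0 /disc_area (_ : sqn @^-1` _ = set0) ?measure0 ?mule0//.
apply/seteqP; split => -[x y] //=; rewrite in_itv/= /sqn/= => h.
have := sqr_ge0 x; have := sqr_ge0 y; lra.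
Qed.

(** The area of a disc is proportional to its squared radius, so this image is a
    multiple of Lebesgue measure on the half-line. Adding Lebesgue measure on the
    negative half-line reduces this to the uniqueness of Lebesgue measure. *)
Lemma sqn_law_lebesgue : exists2 a : R, (0 < a)%R &
  forall A : set (measurableTypeR R), measurable A -> A `<=` `[0%R, 1%R[ ->
  sqn_law A = a%:E * lam A.
Proof.
have [a a0 aE] := sqn_law_itvNy; exists a => //.
have mneg : measurable (`]-oo, 0%R]%classic : set (measurableTypeR R)) by exact: measurable_itv.
have ai0 : (0 <= a^-1)%R by rewrite invr_ge0 ltW.
pose m1 : {measure set (measurableTypeR R) -> \bar R} := mscale (NngNum ai0) sqn_law.
pose m2 : {measure set (measurableTypeR R) -> \bar R} := mrestr lam mneg.
pose m : {measure set (measurableTypeR R) -> \bar R} := measure_add m1 m2.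
have mE A : m A = a^-1%:E * sqn_law A + lam (A `&` `]-oo, 0%R]).
  exact: (measure_addE m1 m2 A).
have lamm A : measurable A -> lam A = m A.
  apply: (@lebesgue_measure_unique R m) => // _ [[u v]] _ <-.
  rewrite mE [(u, v).1]/= [(u, v).2]/=.
  have [uv|vu] := ltP u v; last first.
    by rewrite set_itv_ge ?bnd_simp -?leNgt// set0I (measure0 sqn_law) !measure0 mule0 add0e.
  have -> : sqn_law `]u, v]%classic = (a * Num.max v 0 - a * Num.max u 0)%:E.
    have -> : `]u, v]%classic = `]-oo, v]%classic `\` `]-oo, u]%classic.
      apply/seteqP; split => x /=; rewrite !in_itv/=.
        by move=> /andP[h1 h2]; split => //; apply/negP; rewrite -ltNge.
      by move=> [-> /negP]; rewrite -ltNge => ->.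
    rewrite measureD//.
    - rewrite setIidr; last by apply: subset_itvl; rewrite bnd_simp ltW.
      rewrite EFinB; congr (_ - _); exact: aE.
    - by have := aE v; rewrite /= => ->; exact: ltry.
  have -> : lam (`]u, v]%classic `&` `]-oo, 0%R]%classic) = (Num.min v 0 - Num.min u 0)%:E.
    have -> : `]u, v]%classic `&` `]-oo, 0%R]%classic = `]u, (Num.min v 0)%R]%classic.
      apply/seteqP; split => x /=; rewrite !in_itv/= le_min.
        by move=> [/andP[-> ->] ->].
      by move=> /and3P[-> -> ->].
    rewrite lebesgue_measure_itv/= lte_fin lt_min uv/=.
    have [u0|u0] := ltP u 0%R; first by rewrite -EFinB.
    by rewrite min_r ?subrr// (le_trans u0)// ltW.
  rewrite lebesgue_measure_itv/= lte_fin uv -EFinM -!EFinD; congr (_%:E).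
  rewrite -mulrBr mulrA mulVf ?gt_eqF// mul1r.
  by have := addr_max_min v 0%R; have := addr_max_min u 0%R; lra.
move=> A mA A01; rewrite (lamm A mA) mE.
have -> : lam (A `&` `]-oo, 0%R]) = 0.
  apply/eqP; rewrite eq_le measure_ge0 andbT.
  rewrite -(lebesgue_measure_set1 (0 : R)%R); apply: le_measure; rewrite ?inE.
  - exact: measurableI.
  - exact: measurable_set1.
  - move=> x [/A01/=]; rewrite !in_itv/= => /andP[x0 _] x0'.
    by apply/eqP; rewrite eq_le x0 x0'.
by rewrite adde0 muleA -EFinM divff ?gt_eqF// mul1e.
Qed.

Lemma cabs_toC (xy : R * R) : (cabs (toC xy) ^+ 2)%R = sqn xy.
Proof. by rewrite cabs_sqr. Qed.

Lemma unit_discE : @toC R @^-1` @unit_disc R = sqn @^-1` `[0%R, 1%R[%classic.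
Proof.
apply/seteqP; split => xy /=; rewrite in_itv/= -cabs_toC sqr_ge0/= /unit_disc/=.
  by move=> h; rewrite expr_lt1// cabs_ge0.
by rewrite expr_lt1// cabs_ge0.
Qed.

Lemma measurable_unit_disc :
  measurable (@toC R @^-1` @unit_disc R : set (measurableTypeR R * measurableTypeR R)).
Proof. by rewrite unit_discE; apply: measurable_sqn_preimage. Qed.

(** Integration in polar coordinates, in the variable [t = |z|^2]. The constant
    is the normalized area of the unit disc. *)
Lemma disc_int_radial : exists2 a : R, (0 < a)%R & forall G : R -> R,
  measurable_fun (`[0%R, 1%R[%classic : set (measurableTypeR R)) G ->
  (forall t, (0 <= t < 1 -> 0 <= G t)%R) ->
  disc_int (fun z => G (cabs z ^+ 2)%R) = a%:E * \int[lam]_(t in `[0%R, 1%R[) (G t)%:E.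
Proof.
have [a a0 aE] := sqn_law_lebesgue; exists a => // G mG G0.
have mD : measurable (`[0%R, 1%R[%classic : set (measurableTypeR R)) by exact: measurable_itv.
have mEG : measurable_fun (`[0%R, 1%R[%classic : set (measurableTypeR R)) (EFin \o G).
  exact/measurable_EFinP.
have EG0 t : `[0%R, 1%R[%classic t -> 0 <= (EFin \o G) t.
  by move=> /=; rewrite in_itv/= lee_fin => /G0.
rewrite /disc_int unit_discE.
under eq_integral do rewrite cabs_toC.
have := @ge0_integral_pushforward _ _ _ _ _ _ (@measurable_sqn R) (dA R) _ _ mD mEG.
rewrite /= => <-; last by move=> t; rewrite inE => /EG0.
have := @ge0_integral_mscale _ _ _ lam _ mD (NngNum (ltW a0)) _ mEG EG0.
move=> /= <-; apply: (@eq_measure_integral _ _ _ _ _ sqn_law) => A mA A01.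
exact: aE.
Qed.

End RadialIntegral.

(** * The rapidly increasing weight *)

Section LogarithmicDensities.
Context {R : realType}.
Implicit Types (a b c s t x : R).
Local Notation lam := (@lebesgue_measure R).

Lemma FTC2_is_derive (f F : R -> R) a b : a < b ->
  (forall x, a <= x <= b -> is_derive x 1 F (f x)) ->
  (forall x, a <= x <= b -> {for x, continuous f}) ->
  (\int[lam]_(x in `[a, b]) (f x)%:E = (F b - F a)%:E)%E.
Proof.
move=> ab dF cf.
have cF x : a <= x <= b -> {for x, continuous F}.
  by move=> /dF [d _]; apply: differentiable_continuous; exact/derivable1_diffP.
rewrite EFinB; apply: continuous_FTC2 => //.
- apply: continuous_in_subspaceT => x; rewrite inE/= in_itv/=; exact: cf.
- split.
  + by move=> x; rewrite in_itv/= => /andP[ax xb]; have [] := dF x; rewrite ?(ltW ax) ?(ltW xb).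
  + by apply: cvg_at_right_filter; apply: cF; rewrite lexx ltW.
  + by apply: cvg_at_left_filter; apply: cF; rewrite lexx ltW.
- move=> x; rewrite in_itv/= => /andP[ax xb]; rewrite derive1E.
  by apply: derive_val; apply: dF; rewrite (ltW ax) (ltW xb).
Qed.

Definition loglog t : R := ln (logf t).

Lemma logf_gt0 t : 0 <= t < 1 -> 0 < logf t.
Proof. by move=> /logf_ge1; lra. Qed.

Lemma loglog_ge0 t : 0 <= t < 1 -> 0 <= loglog t.
Proof. by move=> /logf_ge1; exact: ln_ge0. Qed.

Lemma is_derive_logf t : t < 1 -> is_derive t 1 logf (1 - t)^-1.
Proof.
move=> t1; have t1' : 0 < 1 - t by lra.
have h1 : is_derive t (1:R) (fun x : R => 1 - x) (-1).
  by apply: is_derive_eq; rewrite add0r mul1r.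
have h2 := @is_derive1_comp R (@ln R) (fun x => 1 - x) t _ _ (is_derive1_ln t1') h1.
have h3 : is_derive t (1:R) (cst 1 - (@ln R \o (fun x : R => 1 - x))) (0 - ((1 - t)^-1 * -1)).
  exact: is_deriveB.
by apply: (@is_derive_eq _ _ _ _ _ _ _ _ h3); rewrite mulrN1 opprK add0r.
Qed.

Lemma is_derive_loglog t : 0 <= t < 1 ->
  is_derive t 1 loglog (expR (- loglog t) / (1 - t)).
Proof.
move=> t01; have l0 := logf_gt0 t01; case/andP: (t01) => _ t1.
have := is_derive1_comp (is_derive1_ln l0) (is_derive_logf t1).
by rewrite expRN /loglog lnK.
Qed.

(** The density [(logf t) `^ (- b) / (1 - t)], in exponential form. *)
Definition logdens b t : R := expR (- b * loglog t) / (1 - t).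

Lemma logdens_ge0 b t : t < 1 -> 0 <= logdens b t.
Proof. by move=> t1; rewrite divr_ge0 ?expR_ge0//; lra. Qed.

Lemma is_derive_explog c t : 0 <= t < 1 ->
  is_derive t 1 (fun x => expR (c * loglog x)) (c * logdens (1 - c) t).
Proof.
move=> t01.
have h1 : is_derive t 1 (fun x => c * loglog x) (c * (expR (- loglog t) / (1 - t))).
  have h := is_derive_loglog t01.
  exact: (@is_deriveZ _ _ _ loglog c t 1 _ h).
have := is_derive1_comp (is_derive_expR _) h1.
move=> h; apply: (@is_derive_eq _ _ _ _ _ _ _ _ h).
rewrite /logdens mulrCA; congr (_ * _); rewrite mulrA -expRD; congr (expR _ / _).
ring.
Qed.

Lemma continuous_logdens b t : 0 <= t < 1 -> {for t, continuous (logdens b)}.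
Proof.
move=> t01; case/andP: (t01) => t0 t1; apply: continuousM.
  have [d _] := is_derive_explog (- b) t01.
  by apply: differentiable_continuous; exact/derivable1_diffP.
apply: continuousV; first by rewrite gt_eqF//; lra.
by apply: continuousB; [exact: cst_continuous|exact: cvg_id].
Qed.

Lemma measurable_logf : measurable_fun [set: R] (@logf R).
Proof.
apply: measurable_funB; first exact: measurable_cst.
apply: measurableT_comp; first exact: measurable_ln.
by apply: measurable_funB; [exact: measurable_cst|exact: measurable_id].
Qed.

Lemma measurable_logdens b : measurable_fun [set: R] (logdens b).
Proof.
have h : measurable_fun [set: R] (fun t : R => (1 - t) `^ (-1)).
  apply: (measurableT_comp (@measurable_powR R (-1))).
  by apply: measurable_funB; [exact: measurable_cst|exact: measurable_id].
rewrite /logdens; apply: measurable_funM.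
  apply: measurableT_comp => //; apply: measurable_funM; first exact: measurable_cst.
  by apply: measurableT_comp; [exact: measurable_ln|exact: measurable_logf].
(* On either side of 1 the inverse is, up to sign, a power. *)
rewrite (_ : (fun _ => _) = (fun t : R => if 0 <= 1 - t then (1 - t) `^ (-1)
    else - (- (1 - t)) `^ (-1))); last first.
  apply/funext => t; case: ifPn => h0; first by rewrite powR_inv1.
  by rewrite powR_inv1 ?invrN ?opprK// oppr_ge0 ltW// ltNge.
apply: measurable_fun_ifT => //.
  apply: measurable_fun_ler; first exact: measurable_cst.
  by apply: measurable_funB; [exact: measurable_cst|exact: measurable_id].
apply: measurable_funN; apply: (measurableT_comp (@measurable_powR R (-1))).
by apply: measurable_funN; apply: measurable_funB; [exact: measurable_cst|exact: measurable_id].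
Qed.

Lemma integral_logdens1 a b : 0 <= a -> a < b -> b < 1 ->
  (\int[lam]_(x in `[a, b]) (logdens 1 x)%:E = (loglog b - loglog a)%:E)%E.
Proof.
move=> a0 ab b1; apply: FTC2_is_derive => // x /andP[ax xb].
- have x01 : 0 <= x < 1 by rewrite (le_trans a0)//= (le_lt_trans xb).
  apply: (@is_derive_eq _ _ _ _ _ _ _ _ (is_derive_loglog x01)).
  by rewrite /logdens mulN1r.
- by apply: continuous_logdens; rewrite (le_trans a0)//= (le_lt_trans xb).
Qed.

(** An antiderivative is [- (logf t) `^ (1 - b) / (b - 1)], which is bounded. *)
Lemma integral_logdens_lty b : 1 < b ->
  (\int[lam]_(x in `[0%R, 1%R[) (logdens b x)%:E < +oo)%E.
Proof.
move=> b1; pose c := b - 1.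
have c0 : 0 < c by rewrite /c; lra.
pose F n : set R := `[0, 1 - n.+2%:R^-1]%classic.
have i01 n : 0 < (n.+2%:R^-1 : R) < 1.
  by rewrite invr_gt0 ltr0n/= invf_lt1// ltr1n.
have UF : `[0%R, 1%R[%classic = \bigcup_n F n.
  apply/seteqP; split => x /=.
    rewrite in_itv/= => /andP[x0 x1].
    have h : 0 < 1 - x by lra.
    exists (Num.truncn ((1 - x)^-1)) => //; rewrite /F/= in_itv/= x0/=.
    have : (Num.truncn (1 - x)^-1).+2%:R^-1 <= 1 - x.
      rewrite invf_ple ?posrE//; apply: ltW.
      by apply: lt_le_trans (truncnS_gt _) _; rewrite ler_nat.
    by rewrite lerBrDr addrC -lerBrDr.
  move=> [n _]; rewrite /F/= !in_itv/= => /andP[-> h]/=.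
  by have := i01 n; move: (n.+2%:R^-1) h => w; lra.
have bnd n : (\int[lam]_(x in F n) (logdens b x)%:E <= (c^-1)%:E)%E.
  have /andP[i0 i1] := i01 n.
  have sub x : 0 <= x <= 1 - n.+2%:R^-1 -> 0 <= x < 1.
    by move: i0 i1; move: (n.+2%:R^-1) => w i0 i1 /andP[-> xn]; lra.
  have dH x : 0 <= x <= 1 - n.+2%:R^-1 ->
      is_derive x 1 (fun x => - c^-1 * expR (- c * loglog x)) (logdens b x).
    move=> /sub h; have h1 := is_derive_explog (- c) h.
    apply: (@is_derive_eq _ _ _ _ _ _ _ _ (@is_deriveZ _ _ _ _ (- c^-1) _ _ _ h1)).
    have -> : b = 1 - - c by rewrite /c; ring.
    change (- c^-1 * (- c * logdens (1 - - c) x) = logdens (1 - - c) x).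
    by rewrite mulrA mulrNN mulVf ?gt_eqF// mul1r.
  have lt01 : 0 < 1 - (n.+2%:R^-1 : R).
    by move: i0 i1; move: (n.+2%:R^-1) => w; lra.
  rewrite (FTC2_is_derive lt01 dH); last by move=> x /sub; exact: continuous_logdens.
  have h01 : 0 <= (0 : R) < 1 by rewrite lexx ltr01.
  rewrite lee_fin.
  have e1 : expR (- c * loglog 0) <= 1.
    by rewrite -expR0 ler_expR; have := loglog_ge0 h01; nra.
  have e2 : 0 < expR (- c * loglog (1 - n.+2%:R^-1)) by exact: expR_gt0.
  have ci : 0 < c^-1 by rewrite invr_gt0.
  nra.
apply: (@le_lt_trans _ _ (c^-1)%:E); last exact: ltry.
rewrite UF.
have ndF : nondecreasing_seq F.
  move=> m n mn; rewrite subsetEset; apply: subset_itvl.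
  by rewrite bnd_simp lerD2l lerN2 lef_pV2 ?posrE ?ltr0n// ler_nat !ltnS.
have mF : forall k, measurable (F k : set (measurableTypeR R)).
  by move=> k; exact: measurable_itv.
have mf : forall k, measurable_fun (F k : set (measurableTypeR R)) (EFin \o logdens b).
  by move=> k; apply/measurable_EFinP; apply: measurable_funTS; exact: measurable_logdens.
have f0 : forall k (x : R), F k x -> (0 <= (EFin \o logdens b) x)%E.
  move=> k x.
  rewrite /F/= in_itv/= lee_fin => /andP[_ h]; apply: logdens_ge0.
  by have := i01 k; move: (k.+2%:R^-1) h => w; lra.
have cv := @ge0_nondecreasing_set_cvg_integral _ (measurableTypeR R) R F
  (EFin \o logdens b) lam ndF mF mf f0.
rewrite -(cvg_lim (@ereal_hausdorff R) cv).
apply: lime_le; last by apply: nearW => n; exact: bnd.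
exact: (cvgP _ cv).
Qed.

End LogarithmicDensities.

Section Weight.
Context {R : realType}.
Implicit Types (a b c s t x : R) (z : R[i]^o).
Local Notation lam := (@lebesgue_measure R).

Definition log_weight b z : R := logdens b (cabs z ^+ 2).

Lemma sqr_itv01 x : 0 <= x < 1 -> 0 <= x ^+ 2 < 1.
Proof. by move=> /andP[x0 x1]; rewrite sqr_ge0 expr_lt1. Qed.

Lemma unit_disc_sqr z : unit_disc z -> 0 <= cabs z ^+ 2 < 1.
Proof. by move=> z1; apply: sqr_itv01; rewrite cabs_ge0. Qed.

Lemma logdens_gt0 b t : t < 1 -> 0 < logdens b t.
Proof. by move=> t1; rewrite divr_gt0 ?expR_gt0//; lra. Qed.

Lemma cabs_real_sqr x : cabs (x%:C)%C ^+ 2 = x ^+ 2.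
Proof. by rewrite cabs_sqr/= expr0n/= addr0. Qed.

Lemma continuous_cabs : continuous (@cabs R).
Proof.
move=> z.
apply/(@cvgrPdist_lt R R _ (nbhs (z : R[i]^o)) (nbhs_filter (z : R[i]^o))) => e e0.
have e0' : 0 < (e%:C)%C :> R[i] by rewrite ltcR.
apply: (@filterS _ _ (nbhs_filter (z : R[i]^o)) _ _ _ (@nbhsx_ballx _ (R[i]^o) z _ e0')) => w zw.
have {zw} : `|z - w| < (e%:C)%C :> R[i] by exact: zw.
rewrite [`|z - w|](_ : _ = ((cabs (z - w))%:C)%C)// ltcR; apply: le_lt_trans.
rewrite ler_norml.
have h1 := cabsD (z - w) w; have h2 := cabsD (w - z) z.
rewrite !subrK in h1 h2.
have h3 : cabs (w - z) = cabs (z - w) by rewrite -(cabsN (w - z)) opprB.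
apply/andP; split; lra.
Qed.

Lemma measurable_log_weight (b : R) :
  measurable_fun (@toC R @^-1` @unit_disc R)
    (fun xy : measurableTypeR R * measurableTypeR R => log_weight b (toC xy)).
Proof.
apply: measurable_funTS.
rewrite (_ : (fun _ => _) = logdens b \o @sqn R); last first.
  by apply/funext => xy; rewrite /log_weight cabs_toC.
by apply: measurableT_comp; [exact: measurable_logdens|exact: measurable_sqn].
Qed.

Lemma log_weight_ge0 (b : R) z : unit_disc z -> 0 <= log_weight b z.
Proof. by move=> /unit_disc_sqr/andP[_]; exact: logdens_ge0. Qed.

Lemma weight_log_weight b : 1 < b -> weight (log_weight b).
Proof.
move=> b1; split.
  by move=> z /unit_disc_sqr/andP[_]; exact: logdens_gt0.
apply/integrableP; split.
  by apply/measurable_EFinP; exact: measurable_log_weight.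
rewrite (eq_integral (fun xy : measurableTypeR R * measurableTypeR R =>
    (log_weight b (toC xy))%:E)); last first.
  move=> xy; rewrite inE => /unit_disc_sqr/andP[_ h].
  by rewrite /= ger0_norm// logdens_ge0.
have [a a0 aE] := @disc_int_radial R.
have := aE (logdens b); rewrite /disc_int => -> //.
- by rewrite lte_mul_pinfty ?lee_fin ?ltW// integral_logdens_lty.
- by apply: measurable_funTS; exact: measurable_logdens.
- by move=> t /andP[_]; exact: logdens_ge0.
Qed.

(** The integral of [logdens b (s ^+ 2)] over [[r, 1[] is at least half that of
    [2 * s * logdens b (s ^+ 2)], which has an antiderivative. It is computed
    up to the point [T] at which the power [1 - b] of [logf (T ^+ 2)] has dropped to
    half its value at [r]. *)
Lemma logdens_tail b r : 1 < b -> 0 <= r < 1 ->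
  ((expR (- (b - 1) * loglog (r ^+ 2)) / (4 * (b - 1)))%:E
   <= \int[lam]_(s in `[r, 1%R[) (logdens b (s ^+ 2))%:E)%E.
Proof.
move=> b1 r01; set c := b - 1; have c0 : 0 < c by rewrite /c; lra.
have r201 := sqr_itv01 r01; case/andP: (r01) => r0 r1.
set L := logf (r ^+ 2); have L1 : 1 <= L by exact: logf_ge1.
pose L' := L * expR (ln 2 / c).
have ex1 : 1 < expR (ln 2 / c) by rewrite expR_gt1 divr_gt0// ln_gt0// ltr1n.
have LL' : L < L' by rewrite /L' ltr_pMr//; lra.
(* At t, which is to be T ^+ 2, the function logf takes the value L'. *)
pose t := 1 - expR (1 - L').
have t1 : t < 1 by rewrite /t; have := expR_gt0 (1 - L'); lra.
have rt : r ^+ 2 < t.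
  have : expR (1 - L') < 1 - r ^+ 2.
    have p0 : 0 < 1 - r ^+ 2 by lra.
    rewrite -[ltRHS]lnK ?posrE// ltr_expR.
    have : L = 1 - ln (1 - r ^+ 2) by [].
    lra.
  rewrite /t; lra.
have t0 : 0 <= t by lra.
pose T := Num.sqrt t.
have T2 : T ^+ 2 = t by rewrite sqr_sqrtr.
have rT : r < T by rewrite -(@ltr_pXn2r _ 2%N)// ?nnegrE ?sqrtr_ge0// T2.
have T1 : T < 1 by rewrite -(@ltr_pXn2r _ 2%N)// ?nnegrE ?sqrtr_ge0// T2 expr1n.
have llT : loglog t = loglog (r ^+ 2) + ln 2 / c.
  rewrite /loglog -/L /logf {1}/t opprB addrCA subrr addr0 expRK opprB addrCA subrr addr0.
  by rewrite lnM ?posrE ?expR_gt0// ?expRK//; lra.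
pose F s := - (2 * c)^-1 * expR (- c * loglog (s ^+ 2)).
pose f s := logdens b (s ^+ 2) * s.
have sub s : r <= s <= T -> 0 <= s < 1.
  by move=> /andP[rs sT]; rewrite (le_trans r0)//= (le_lt_trans sT).
have dsq s : is_derive s (1 : R) (fun s : R => s ^+ 2) (2 * s).
  have := is_deriveX 2 (is_derive_id s (1 : R)).
  by move=> h; apply: (@is_derive_eq _ _ _ _ _ _ _ _ h); rewrite /GRing.scale/= mulr1 expr1.
have dF s : r <= s <= T -> is_derive s 1 F (f s).
  move=> /sub/sqr_itv01 s01.
  have h1 := is_derive_explog (- c) s01.
  have h2 := @is_derive1_comp R (fun x => expR (- c * loglog x))
    (fun s : R => s ^+ 2) s _ _ h1 (dsq s).
  apply: (@is_derive_eq _ _ _ _ _ _ _ _ (@is_deriveZ _ _ _ _ (- (2 * c)^-1) _ _ _ h2)).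
  have bE : b = 1 - - c by rewrite /c; ring.
  rewrite /f [in RHS]bE; move: (logdens _ _) => l.
  change (- (2 * c)^-1 * (- c * l * (2 * s)) = l * s).
  by field; rewrite gt_eqF.
have cf s : r <= s <= T -> {for s, continuous f}.
  move=> /sub/sqr_itv01 s01; apply: continuousM; last exact: cvg_id.
  apply: (@continuous_comp _ _ _ (fun s : R => s ^+ 2) (logdens b)).
    exact: exprn_continuous.
  exact: continuous_logdens.
have mg : measurable_fun [set: R] (fun s : R => logdens b (s ^+ 2)).
  by apply: measurableT_comp; [exact: measurable_logdens|exact: measurable_funX].
have step1 : (\int[lam]_(s in `[r, T]) (logdens b (s ^+ 2))%:E <=
    \int[lam]_(s in `[r, 1%R[) (logdens b (s ^+ 2))%:E)%E.
  apply: ge0_subset_integral.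
  - exact: measurable_itv.
  - exact: measurable_itv.
  - by apply/measurable_EFinP; exact: measurable_funTS.
  - move=> s /=; rewrite in_itv/= => /andP[rs s1]; rewrite lee_fin logdens_ge0//.
    by have /sqr_itv01/andP[] : 0 <= s < 1 by rewrite (le_trans r0).
  - by apply: subset_itvl; rewrite bnd_simp.
have step2 : (\int[lam]_(s in `[r, T]) (f s)%:E <=
    \int[lam]_(s in `[r, T]) (logdens b (s ^+ 2))%:E)%E.
  apply: le_lower_integral => s; rewrite /= in_itv/= => /sub s01; rewrite lee_fin.
    have /andP[_ h] := sqr_itv01 s01; have := logdens_ge0 b h.
    by move=> h'; apply: mulr_ge0 => //; case/andP: s01.
  have /andP[_ h] := sqr_itv01 s01; have := logdens_ge0 b h.
  rewrite /f; move: (logdens _ _) => l l0; case/andP: s01 => s0 s1.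
  by rewrite ler_piMr// ltW.
apply: (le_trans _ (le_trans step2 step1)).
rewrite (FTC2_is_derive rT dF cf) lee_fin /F T2 llT [- c * (_ + _)]mulrDr expRD.
have -> : expR (- c * (ln 2 / c)) = 2^-1.
  rewrite mulNr mulrCA mulfV ?gt_eqF// mulr1 expRN lnK ?posrE//.
move: (expR _) => E; rewrite [leRHS](_ : _ = E / (4 * c))//.
by field; rewrite gt_eqF.
Qed.

(** By [logdens_tail] the ratio in question is at least
    [(1 + r) * logf (r ^+ 2) / (4 * (b - 1))]. *)
Lemma rapidly_increasing_log_weight b : 1 < b -> rapidly_increasing (log_weight b).
Proof.
move=> b1; split.
- exact: weight_log_weight.
- by move=> z _; rewrite /log_weight cabs_real_sqr.
- apply: continuous_in_subspaceT => z; rewrite inE => /unit_disc_sqr z01.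
  apply: (@continuous_comp _ _ _ (fun z => cabs z ^+ 2) (logdens b)).
    apply: (@continuous_comp _ _ _ (@cabs R) (fun s : R => s ^+ 2)).
      exact: continuous_cabs.
    exact: exprn_continuous.
  exact: continuous_logdens.
- apply/cvgeyPge => M.
  set c := b - 1; have c0 : 0 < c by rewrite /c; lra.
  pose K := 4 * c * M.
  near=> r.
  have r1 : r < 1 by near: r; exact: nbhs_left_lt.
  have r0 : 0 < r by near: r; apply: nbhs_left_gt; exact: ltr01.
  have re : 1 - r < expR (1 - K) / 2.
    by near: r; apply: nbhs_left_ltBl; rewrite divr_gt0// expR_gt0.
  have r01 : 0 <= r < 1 by rewrite ltW.
  have r201 := sqr_itv01 r01.
  have KL : K <= logf (r ^+ 2).
    have p0 : 0 < 1 - r ^+ 2 by lra.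
    have : ln (1 - r ^+ 2) <= 1 - K.
      rewrite -ler_expR lnK ?posrE//.
      have : 1 - r ^+ 2 = (1 - r) * (1 + r) by ring.
      nra.
    rewrite /logf; lra.
  rewrite /log_weight cabs_real_sqr.
  under eq_integral do rewrite cabs_real_sqr.
  have p0 : 0 < logdens b (r ^+ 2) * (1 - r).
    by rewrite mulr_gt0// ?logdens_gt0//; lra.
  apply: (@le_trans _ _ (((logdens b (r ^+ 2) * (1 - r))^-1)%R%:E *
     (expR (- c * loglog (r ^+ 2)) / (4 * c))%:E)%E); last first.
    apply: lee_wpmul2l; first by rewrite lee_fin invr_ge0 ltW.
    exact: logdens_tail.
  rewrite -EFinM lee_fin.
  have l0 := logf_gt0 r201.
  have E1 : expR (- c * loglog (r ^+ 2)) =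
      expR (- b * loglog (r ^+ 2)) * logf (r ^+ 2).
    rewrite -[X in _ = _ * X]lnK ?posrE// -expRD; congr expR.
    by rewrite /c -/(loglog _); ring.
  rewrite E1 /logdens.
  have q0 := expR_gt0 (- b * loglog (r ^+ 2)).
  move: (expR _) q0 => q q0; move: (logf _) KL l0 => L KL l0.
  have -> : (q / (1 - r ^+ 2) * (1 - r))^-1 * (q * L / (4 * c)) = (1 + r) * L / (4 * c).
    have -> : 1 - r ^+ 2 = (1 - r) * (1 + r) by ring.
    field; rewrite !gt_eqF//; lra.
  rewrite ler_pdivlMr ?mulr_gt0//.
  rewrite mulrC -/K; nra.
Unshelve. all: by end_near.
Qed.

End Weight.

Section RadialComparison.
Context {R : realType}.
Implicit Types (b t p : R) (N : nat).
Local Notation lam := (@lebesgue_measure R).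

Lemma powR_logf b c t : 0 <= t < 1 ->
  logf t `^ b * logdens c t = logdens (c - b) t.
Proof.
move=> t01; rewrite /powR gt_eqF ?logf_gt0// -/(loglog t) /logdens mulrA -expRD.
by congr (expR _ / _); ring.
Qed.

Lemma measurable_dyadic_sum N : measurable_fun [set: R] (@dyadic_sum R N).
Proof. by apply: measurable_sum => k; exact: measurable_funX. Qed.

Lemma disc_int_logf_lty b c : 0 <= b -> b + 1 < c ->
  (disc_int (fun z : R[i]^o => ((2 * logf (cabs z ^+ 2)) `^ b * log_weight c z)%R) < +oo)%E.
Proof.
move=> b0 bc; have [a a0 aE] := @disc_int_radial R.
have l0 t : 0 <= t < 1 -> 0 <= logf t by move=> /logf_gt0/ltW.
have := aE (fun t => 2 `^ b * logdens (c - b) t); rewrite /disc_int => h.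
rewrite (eq_integral (fun xy : measurableTypeR R * measurableTypeR R =>
   (2 `^ b * logdens (c - b) (cabs (toC xy) ^+ 2))%:E)); last first.
  move=> xy; rewrite inE => /unit_disc_sqr h'.
  by rewrite powRM ?l0// -mulrA powR_logf.
rewrite h.
- under eq_integral do rewrite EFinM.
  rewrite ge0_integralZl//=.
  + rewrite lte_mul_pinfty ?lee_fin ?ltW// lte_mul_pinfty ?lee_fin ?powR_ge0//.
    by apply: integral_logdens_lty; lra.
  + by apply/measurable_EFinP; apply: measurable_funTS; exact: measurable_logdens.
  + by move=> t; rewrite /= in_itv/= => /andP[_ t1]; rewrite lee_fin logdens_ge0.
- apply: measurable_funTS; apply: measurable_funM; first exact: measurable_cst.
  exact: measurable_logdens.
- by move=> t /andP[_ t1]; rewrite mulr_ge0 ?powR_ge0 ?logdens_ge0.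
Qed.

(** For [t] close to [1] and [N] large the dyadic sum exceeds [logf t / 4], and
    [logf t `^ b * logdens (b + 1) t = logdens 1 t] is the derivative of
    [loglog t], which is unbounded. *)
Lemma disc_int_dyadic_sum_unbounded b (M : R) : 0 < b ->
  exists N, (M%:E <= disc_int (fun z : R[i]^o =>
    (dyadic_sum N.+1 (cabs z ^+ 2) `^ b * log_weight (b + 1) z)%R))%E.
Proof.
move=> b0; have [a a0 aE] := @disc_int_radial R.
(* At t0 the function logf takes the value 4, beyond which logf / 2 - 1 >= logf / 4. *)
pose t0 : R := 1 - expR (- 3).
have e3 : expR (- 3) < (1 : R) by rewrite expR_lt1 oppr_lt0.
have e30 := @expR_gt0 R (- 3).
have l0 : logf t0 = 4 by rewrite /logf /t0 opprB addrCA subrr addr0 expRK; lra.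
pose c : R := 4^-1 `^ b.
have c0 : 0 < c by rewrite powR_gt0.
pose M' := `|M| / (a * c) + 1.
have M'0 : 0 < M' by rewrite ltr_wpDl// divr_ge0// mulr_ge0// ltW.
pose L := expR (M' + ln 4).
have L4 : 4 < L.
  rewrite /L expRD lnK ?posrE// ltr_pMl//; by rewrite expR_gt1.
pose T := 1 - expR (1 - L).
have eT := expR_gt0 (1 - L).
have lT : logf T = L by rewrite /logf /T opprB addrCA subrr addr0 expRK; lra.
have tT : t0 < T by rewrite /t0 /T ltrD2l ltrN2 ltr_expR; lra.
have T1 : T < 1 by rewrite /T; lra.
have t00 : 0 <= t0 by rewrite /t0; lra.
have [N NT] : exists N, 1 <= 2 ^+ N.+2 * (1 - T).
  have p0 : 0 < 1 - T by rewrite subr_gt0.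
  exists (Num.truncn (1 - T)^-1).
  rewrite -ler_pdivrMr// mul1r (le_trans (ltW (truncnS_gt _)))//.
  by rewrite -natrX ler_nat (leq_trans _ (ltnW (ltn_expl _ _))).
exists N.
pose G t := dyadic_sum N.+1 t `^ b * logdens (b + 1) t.
have mG : measurable_fun [set: R] G.
  apply: measurable_funM; last exact: measurable_logdens.
  by apply: (measurableT_comp (@measurable_powR R b)); exact: measurable_dyadic_sum.
have G0 t : t < 1 -> 0 <= G t.
  by move=> t1; rewrite mulr_ge0 ?powR_ge0 ?logdens_ge0.
have -> := aE G (measurable_funTS mG) (fun t h => G0 t (proj2 (andP h))).
have low : ((c * M')%:E <= \int[lam]_(t in `[0%R, 1%R[) (G t)%:E)%E.
  apply: (@le_trans _ _ (\int[lam]_(t in `[t0, T]) (G t)%:E)%E); last first.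
    apply: ge0_subset_integral.
    - exact: measurable_itv.
    - exact: measurable_itv.
    - by apply/measurable_EFinP; exact: measurable_funTS.
    - by move=> t; rewrite /= in_itv/= => /andP[_ t1]; rewrite lee_fin G0.
    - by move=> t; rewrite /= !in_itv/= => /andP[h1 h2]; rewrite (le_trans t00)//= (le_lt_trans h2).
  apply: (@le_trans _ _ (\int[lam]_(t in `[t0, T]) (c * logdens 1 t)%:E)%E); last first.
    apply: le_lower_integral => t; rewrite /= in_itv/= => /andP[h1 h2];
      have t1 := le_lt_trans h2 T1; rewrite lee_fin.
      by rewrite mulr_ge0 ?(ltW c0)// logdens_ge0.
    have t01 : 0 <= t < 1 by rewrite (le_trans t00).
    have lt4 : 4 <= logf t.
      have ll : ln (1 - t) <= ln (1 - t0).
        by rewrite ler_ln ?posrE ?lerD2l ?lerN2// subr_gt0// (lt_trans tT).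
      by rewrite -[leLHS]l0 lerD2l lerN2.
    have gl : logf t / 4 <= dyadic_sum N.+1 t.
      apply: le_trans (dyadic_sum_ge t01 _); first by lra.
      by rewrite (le_trans NT)// ler_wpM2l ?exprn_ge0//; lra.
    rewrite (_ : logdens 1 t = logf t `^ b * logdens (b + 1) t); last first.
      by rewrite powR_logf// [b + 1]addrC addrK.
    rewrite mulrA ler_wpM2r ?logdens_ge0// /c -powRM//; last lra.
    by apply: (ge0_ler_powR (ltW b0)); rewrite ?nnegrE ?dyadic_sum_ge0//; lra.
  under eq_integral do rewrite EFinM.
  rewrite ge0_integralZl//=.
  - rewrite integral_logdens1// -EFinM lee_fin /loglog lT l0 /L expRK addrK.
    exact: lexx.
  - by apply/measurable_EFinP; apply: measurable_funTS; exact: measurable_logdens.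
  - by move=> t; rewrite /= in_itv/= => /andP[h1 h2];
    rewrite lee_fin logdens_ge0// (le_lt_trans h2).
  - by rewrite lee_fin ltW.
apply: (@le_trans _ _ (a%:E * (c * M')%:E)%E); last first.
  by apply: lee_wpmul2l => //; rewrite lee_fin ltW.
rewrite -EFinM lee_fin mulrA /M' mulrDr mulrCA divff ?mulr1; last first.
  by rewrite gt_eqF// mulr_gt0.
have := ler_norm M; have : 0 < a * c by rewrite mulr_gt0.
lra.
Qed.

End RadialComparison.

(** * Lacunary polynomials as test functions *)

Section LacunaryPolynomials.
Context {R : realType}.
Implicit Types (z : R[i]^o) (p : R).

Lemma is_derive_monomial (n : nat) z (c : R[i]) :
  is_derive z (1 : R[i]^o) (fun w : R[i]^o => c * w ^+ n : R[i]^o) (c * (n%:R * z ^+ n.-1)).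
Proof.
have h : is_derive z (1 : R[i]^o) (fun w : R[i]^o => w ^+ n : R[i]^o) (n%:R * z ^+ n.-1).
  split; first exact: (@exprn_derivable R[i] n z 1).
  rewrite (@exp_derive R[i] n z 1).
  by rewrite /GRing.scale/= mulr1.
exact: (@is_deriveZ _ _ _ (fun w : R[i]^o => w ^+ n : R[i]^o) c z 1 _ h).
Qed.

Lemma is_derive_signed_sum N (e : {ffun 'I_N -> bool}) (n : 'I_N -> nat) z :
  is_derive z (1 : R[i]^o) (fun w : R[i]^o => signed_sum (fun k => w ^+ n k) e : R[i]^o)
    (signed_sum (fun k => (n k)%:R * z ^+ (n k).-1) e).
Proof.
have h := @is_derive_sum _ _ _ N (fun k (w : R[i]^o) => (-1) ^+ e k * w ^+ n k : R[i]^o) z 1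
  (fun k => (-1) ^+ e k * ((n k)%:R * z ^+ (n k).-1)) (fun k => is_derive_monomial (n k) z _).
rewrite /signed_sum.
rewrite [X in is_derive _ _ X _](_ : _ =
  \sum_(k < N) (fun w : R[i]^o => (-1) ^+ e k * w ^+ n k : R[i]^o))//.
by apply/funext => w; rewrite fct_sumE.
Qed.

Lemma analytic_of_is_derive (f df : R[i]^o -> R[i]^o) :
  (forall z, is_derive z 1 f (df z)) -> analytic_in_disc f /\ derive1 f = df.
Proof.
move=> h; split; first by move=> z _; have [] := h z.
by apply/funext => z; rewrite derive1E; apply: derive_val.
Qed.

Definition complex_measurable (g : measurableTypeR R * measurableTypeR R -> R[i]) :=
  measurable_fun setT (fun xy => complex.Re (g xy) : measurableTypeR R) /\
  measurable_fun setT (fun xy => complex.Im (g xy) : measurableTypeR R).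

Lemma complex_measurable_cst (c : R[i]) : complex_measurable (fun=> c).
Proof. by split; exact: measurable_cst. Qed.

Lemma complex_measurable_toC : complex_measurable (@toC R).
Proof. by split; [exact: measurable_fst|exact: measurable_snd]. Qed.

Lemma complex_measurableD g h : complex_measurable g -> complex_measurable h ->
  complex_measurable (fun xy => g xy + h xy).
Proof.
move=> [g1 g2] [h1 h2]; split.
- rewrite (_ : (fun _ => _) = (fun xy => complex.Re (g xy) + complex.Re (h xy))).
    exact: (measurable_funD g1 h1).
  by apply/funext => xy; rewrite raddfD.
- rewrite (_ : (fun _ => _) = (fun xy => complex.Im (g xy) + complex.Im (h xy))).
    exact: (measurable_funD g2 h2).
  by apply/funext => xy; rewrite raddfD.
Qed.

Lemma complex_measurableM g h : complex_measurable g -> complex_measurable h ->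
  complex_measurable (fun xy => g xy * h xy).
Proof.
move=> [g1 g2] [h1 h2]; split.
- rewrite (_ : (fun _ => _) = (fun xy => complex.Re (g xy) * complex.Re (h xy)
    - complex.Im (g xy) * complex.Im (h xy))).
    exact: (measurable_funB (measurable_funM g1 h1) (measurable_funM g2 h2)).
  by apply/funext => xy; case: (g xy) => a b; case: (h xy).
- rewrite (_ : (fun _ => _) = (fun xy => complex.Re (g xy) * complex.Im (h xy)
    + complex.Im (g xy) * complex.Re (h xy))).
    exact: (measurable_funD (measurable_funM g1 h2) (measurable_funM g2 h1)).
  by apply/funext => xy; case: (g xy) => a b; case: (h xy).
Qed.

Lemma complex_measurableX g n : complex_measurable g ->
  complex_measurable (fun xy => g xy ^+ n).
Proof.
move=> mg; elim: n => [|n ih].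
  by under eq_fun do rewrite expr0; exact: complex_measurable_cst.
by under eq_fun do rewrite exprS; exact: complex_measurableM.
Qed.

Lemma complex_measurable_sum N (g : 'I_N -> _ -> R[i]) :
  (forall k, complex_measurable (g k)) ->
  complex_measurable (fun xy => \sum_k g k xy).
Proof.
move=> mg; rewrite -fct_sumE; apply: (big_ind complex_measurable) => //.
by move=> g1 g2; exact: complex_measurableD.
Qed.

Lemma measurable_cabs g : complex_measurable g ->
  measurable_fun setT (fun xy => cabs (g xy) : measurableTypeR R).
Proof.
move=> [g1 g2].
rewrite (_ : (fun _ => _) = Num.sqrt \o
    (fun xy => complex.Re (g xy) ^+ 2 + complex.Im (g xy) ^+ 2)).
  apply: measurableT_comp.
    by apply: continuous_measurable_fun; exact: sqrt_continuous.
  exact: (measurable_funD (measurable_funX 2 g1) (measurable_funX 2 g2)).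
by apply/funext => xy /=; rewrite -cabs_sqr sqrtr_sqr ger0_norm// cabs_ge0.
Qed.

Lemma measurable_cabs_signed_sum N (a : 'I_N -> R[i]) (n : 'I_N -> nat)
    (e : {ffun 'I_N -> bool}) p :
  measurable_fun setT (fun xy : measurableTypeR R * measurableTypeR R =>
    cabs (signed_sum (fun k => a k * toC xy ^+ n k) e) `^ p : measurableTypeR R).
Proof.
apply: (measurableT_comp (@measurable_powR R p)); apply: measurable_cabs.
apply: complex_measurable_sum => k; apply: complex_measurableM.
  exact: complex_measurable_cst.
apply: complex_measurableM; first exact: complex_measurable_cst.
by apply: complex_measurableX; exact: complex_measurable_toC.
Qed.

End LacunaryPolynomials.

Section Comparison.
Context {R : realType}.
Local Notation disc := (@toC R @^-1` @unit_disc R : set (measurableTypeR R * measurableTypeR R)).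
Local Notation plane := (measurableTypeR R * measurableTypeR R)%type.
Implicit Types (u v : plane -> R).

Definition planar_int u : \bar R := (\int[dA R]_(xy in disc) (u xy)%:E)%E.

Lemma planar_int_le u v : (forall xy, disc xy -> 0 <= u xy <= v xy) ->
  (planar_int u <= planar_int v)%E.
Proof.
by move=> uv; apply: le_lower_integral => xy /uv/andP[]; rewrite !lee_fin.
Qed.

Lemma planar_int_ge0 u : (forall xy, disc xy -> 0 <= u xy) -> (0 <= planar_int u)%E.
Proof. by move=> u0; apply: integral_ge0 => xy /u0; rewrite lee_fin. Qed.

Lemma planar_intZ (c : R) u : 0 <= c -> measurable_fun disc u ->
  (forall xy, disc xy -> 0 <= u xy) ->
  planar_int (fun xy => c * u xy) = (c%:E * planar_int u)%E.
Proof.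
move=> c0 mu u0; rewrite /planar_int; under eq_integral do rewrite EFinM.
rewrite ge0_integralZl_EFin//.
- exact: measurable_unit_disc.
- exact/measurable_EFinP.
Qed.

Lemma planar_int_sum (I : finType) (u : I -> plane -> R) :
  (forall i, measurable_fun disc (u i)) ->
  (forall i xy, disc xy -> 0 <= u i xy) ->
  planar_int (fun xy => \sum_i u i xy) = (\sum_i planar_int (u i))%E.
Proof.
move=> mu u0; rewrite /planar_int; under eq_integral do rewrite -sumEFin.
rewrite ge0_integral_sum//.
- exact: measurable_unit_disc.
- by move=> i; exact/measurable_EFinP.
Qed.

Definition power_sum N (n : 'I_N -> nat) (e : {ffun 'I_N -> bool}) (z : R[i]^o) : R[i]^o :=
  signed_sum (fun k => z ^+ n k) e.

Definition power_sum_deriv N (n : 'I_N -> nat) (e : {ffun 'I_N -> bool}) (z : R[i]^o) : R[i]^o :=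
  signed_sum (fun k => (n k)%:R * z ^+ (n k).-1) e.

Variable p : R.
Hypothesis p0 : 0 < p.

Lemma measurable_power_sum N (n : 'I_N -> nat) e :
  measurable_fun disc (fun xy => cabs (power_sum n e (toC xy)) `^ p : measurableTypeR R).
Proof.
apply: measurable_funTS.
have := @measurable_cabs_signed_sum R N (fun=> 1) n e p.
rewrite (_ : (fun _ => _) = (fun xy => cabs (power_sum n e (toC xy)) `^ p))//.
apply/funext => xy; rewrite /power_sum; congr (cabs (signed_sum _ _) `^ _).
by apply/funext => k; rewrite mul1r.
Qed.

Lemma measurable_power_sum_deriv N (n : 'I_N -> nat) e :
  measurable_fun disc (fun xy => cabs (power_sum_deriv n e (toC xy)) `^ p : measurableTypeR R).
Proof. by apply: measurable_funTS; exact: measurable_cabs_signed_sum. Qed.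

Variable omega : R[i]^o -> R.
Hypothesis momega : measurable_fun disc (fun xy => omega (toC xy)).
Hypothesis omega0 : forall z, unit_disc z -> 0 <= omega z.

Lemma derivative_normp_power_sum (phi : R -> R) N (n : 'I_N -> nat) e :
  (forall k, (0 < n k)%N) ->
  derivative_normp p omega phi (power_sum n e) =
  planar_int (fun xy => cabs (power_sum_deriv n e (toC xy)) `^ p *
    (phi (cabs (toC xy)) `^ p * omega (toC xy))).
Proof.
move=> n0; rewrite /derivative_normp.
have [_ dE] := @analytic_of_is_derive R (power_sum n e) (power_sum_deriv n e)
  (fun z => is_derive_signed_sum e n z).
rewrite dE.
have -> : power_sum n e 0 = 0.
  by rewrite /power_sum /signed_sum big1// => k _; rewrite expr0n gtn_eqF// mulr0.
have -> : cabs (0 : R[i]^o) = 0 by exact: ComplexField.Normc.normc0.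
rewrite powR0 ?gt_eqF// adde0 /disc_int.
by rewrite /planar_int; under eq_integral do rewrite -mulrA.
Qed.

(** The comparison of norms for the polynomials [power_sum n e], with [h] in the
    place of phi^p omega. They vanish at the origin when all exponents are
    positive, so the term |f(0)|^p disappears. *)
Definition comparable_on_power_sums (C : R) (h : plane -> R) :=
  forall N (n : 'I_N -> nat) e, (forall k, (0 < n k)%N) ->
  (planar_int (fun xy => (cabs (power_sum_deriv n e (toC xy)) `^ p * h xy)%R)
     <= C%:E * planar_int (fun xy => (cabs (power_sum n e (toC xy)) `^ p * omega (toC xy))%R))%E
  /\ (planar_int (fun xy => (cabs (power_sum n e (toC xy)) `^ p * omega (toC xy))%R)
     <= C%:E * planar_int (fun xy => (cabs (power_sum_deriv n e (toC xy)) `^ p * h xy)%R))%E.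

(** The function f(z) = z shows that phi^p omega has a finite lower integral,
    so that it has a measurable envelope. *)
Lemma borel_comparison (phi : R -> R) (C : R) : 1 <= C ->
  (planar_int (fun xy => omega (toC xy)) < +oo)%E ->
  (forall f : R[i]^o -> R[i]^o, analytic_in_disc f ->
    (C^-1%:E * derivative_normp p omega phi f
       <= bergman_normp p omega f
       <= C%:E * derivative_normp p omega phi f)%E) ->
  exists h : plane -> R, [/\ measurable_fun disc h, (forall xy, disc xy -> 0 <= h xy) &
    comparable_on_power_sums C h].
Proof.
move=> C1 omegaoo H.
have C0 : 0 < C by lra.
pose g (xy : plane) := phi (cabs (toC xy)) `^ p * omega (toC xy).
have g0 xy : disc xy -> 0 <= g xy.
  by move=> h; rewrite mulr_ge0 ?powR_ge0 ?omega0.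
have cmp N (n : 'I_N -> nat) e (n0 : forall k, (0 < n k)%N) :
  (planar_int (fun xy => (cabs (power_sum_deriv n e (toC xy)) `^ p * g xy)%R)
     <= C%:E * planar_int (fun xy => (cabs (power_sum n e (toC xy)) `^ p * omega (toC xy))%R))%E
  /\ (planar_int (fun xy => (cabs (power_sum n e (toC xy)) `^ p * omega (toC xy))%R)
     <= C%:E * planar_int (fun xy => (cabs (power_sum_deriv n e (toC xy)) `^ p * g xy)%R))%E.
  have [an _] := @analytic_of_is_derive R (power_sum n e) (power_sum_deriv n e)
  (fun z => is_derive_signed_sum e n z).
  have /andP[h1 h2] := H _ an.
  rewrite -(derivative_normp_power_sum phi e n0); split => //.
  by rewrite -lee_pdivrMl.
have goo : (planar_int g < +oo)%E.
  have [h _] := cmp 1%N (fun=> 1%N) [ffun=> false] (fun=> isT).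
  rewrite (_ : (fun _ => _) = g) in h; last first.
    apply/funext => xy; rewrite /power_sum_deriv /signed_sum big_ord1 ffunE expr0 !mul1r.
    have -> : cabs (1 : R[i]^o) = 1 by exact: ComplexField.Normc.normc1.
    by rewrite powR1 mul1r.
  apply: (le_lt_trans h).
  rewrite lte_mul_pinfty ?lee_fin ?ltW//.
  apply: le_lt_trans omegaoo; apply: planar_int_le => xy h1.
  rewrite mulr_ge0 ?powR_ge0 ?omega0//= ler_piMl ?omega0//.
  rewrite /power_sum /signed_sum big_ord1 ffunE expr0 expr1 !mul1r.
  apply: (@le_trans _ _ (1 `^ p)); last by rewrite powR1.
  apply: (ge0_ler_powR (ltW p0)); rewrite ?nnegrE ?cabs_ge0//.
  exact: ltW.
have [h [mh h0 hE]] := lower_envelope measurable_unit_disc g0 goo.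
exists h; split => // N n e n0.
have := cmp N n e n0; rewrite /planar_int hE//.
- exact: measurable_power_sum_deriv.
- by move=> xy _; exact: powR_ge0.
Qed.

End Comparison.

(** * Incompatibility of the two sides *)

Section Contradiction.
Context {R : realType}.
Local Notation disc := (@toC R @^-1` @unit_disc R : set (measurableTypeR R * measurableTypeR R)).
Local Notation plane := (measurableTypeR R * measurableTypeR R)%type.
Variables (p : R) (omega : R[i]^o -> R) (C : R) (h : plane -> R).
Hypothesis p0 : 0 < p.
Hypothesis momega : measurable_fun disc (fun xy => omega (toC xy)).
Hypothesis omega0 : forall z, unit_disc z -> 0 <= omega z.
Hypothesis mh : measurable_fun disc h.
Hypothesis h0 : forall xy, disc xy -> 0 <= h xy.
Hypothesis C0 : 0 <= C.
Hypothesis cmp : comparable_on_power_sums p omega C h.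

Section Families.
Variables (I : finType) (N : nat) (n : I -> 'I_N -> nat) (e : I -> {ffun 'I_N -> bool}).

Definition family_sum (xy : plane) : R :=
  \sum_i cabs (power_sum (n i) (e i) (toC xy)) `^ p * omega (toC xy).

Definition family_deriv_sum (xy : plane) : R :=
  \sum_i cabs (power_sum_deriv (n i) (e i) (toC xy)) `^ p * h xy.

Lemma measurable_family_sum : measurable_fun disc family_sum.
Proof.
apply: measurable_sum => i; apply: measurable_funM => //.
exact: measurable_power_sum.
Qed.

Lemma measurable_family_deriv_sum : measurable_fun disc family_deriv_sum.
Proof.
apply: measurable_sum => i; apply: measurable_funM => //.
exact: measurable_power_sum_deriv.
Qed.

Lemma family_sum_ge0 xy : disc xy -> 0 <= family_sum xy.
Proof. by move=> d; apply: sumr_ge0 => i _; rewrite mulr_ge0 ?powR_ge0 ?omega0. Qed.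

Lemma family_deriv_sum_ge0 xy : disc xy -> 0 <= family_deriv_sum xy.
Proof. by move=> d; apply: sumr_ge0 => i _; rewrite mulr_ge0 ?powR_ge0 ?h0. Qed.

(** Applied to the monomials [z ^+ (2 ^ k)], and to the polynomials given by all
    sign vectors, the average over which is thus compared as a whole. *)
Lemma family_comparison : (forall i k, (0 < n i k)%N) ->
  (planar_int family_deriv_sum <= C%:E * planar_int family_sum)%E /\
  (planar_int family_sum <= C%:E * planar_int family_deriv_sum)%E.
Proof.
move=> n0.
have sumE : planar_int family_sum = (\sum_i planar_int (fun xy =>
    (cabs (power_sum (n i) (e i) (toC xy)) `^ p * omega (toC xy))%R))%E.
  apply: planar_int_sum => i; last by move=> xy d; rewrite mulr_ge0 ?powR_ge0 ?omega0.
  by apply: measurable_funM => //; exact: measurable_power_sum.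
have deriv_sumE : planar_int family_deriv_sum = (\sum_i planar_int (fun xy =>
    (cabs (power_sum_deriv (n i) (e i) (toC xy)) `^ p * h xy)%R))%E.
  apply: planar_int_sum => i; last by move=> xy d; rewrite mulr_ge0 ?powR_ge0 ?h0.
  by apply: measurable_funM => //; exact: measurable_power_sum_deriv.
rewrite sumE deriv_sumE !ge0_sume_distrr; first last.
- by move=> i _; apply: planar_int_ge0 => xy d; rewrite mulr_ge0 ?powR_ge0 ?omega0 ?h0.
- by move=> i _; apply: planar_int_ge0 => xy d; rewrite mulr_ge0 ?powR_ge0 ?omega0 ?h0.
by split; apply: lee_sum => i _; have [] := cmp (e i) (n0 i).
Qed.

End Families.

Variable N : nat.

Let dyadic (_ : {ffun 'I_N.+1 -> bool}) (k : 'I_N.+1) : nat := (2 ^ k)%N.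
Let all_signs (e : {ffun 'I_N.+1 -> bool}) := e.
(* A monomial is a power sum with a single term. *)
Let monomials (k : 'I_N.+1) (_ : 'I_1) : nat := (2 ^ k)%N.
Let plus_sign (k : 'I_N.+1) : {ffun 'I_1 -> bool} := [ffun=> false].

Lemma monomials_sumE xy : family_sum monomials plus_sign xy =
  (\sum_(k < N.+1) (cabs (toC xy) ^+ (2 ^ k)) `^ p) * omega (toC xy).
Proof.
rewrite /family_sum mulr_suml; apply: eq_bigr => k _.
by rewrite /power_sum /signed_sum big_ord1 ffunE expr0 mul1r cabsX.
Qed.

Lemma monomials_deriv_sumE xy : family_deriv_sum monomials plus_sign xy =
  (\sum_(k < N.+1) dyadic_term (cabs (toC xy)) k `^ p) * h xy.
Proof.
rewrite /family_deriv_sum mulr_suml; apply: eq_bigr => k _.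
rewrite /power_sum_deriv /signed_sum big_ord1 ffunE expr0 mul1r.
by rewrite cabsM cabs_nat cabsX /dyadic_term natrX.
Qed.

Lemma cabs_dyadic_term (z : R[i]) (k : nat) :
  cabs ((2 ^ k)%:R * z ^+ (2 ^ k).-1 : R[i]) = dyadic_term (cabs z) k.
Proof. by rewrite cabsM cabs_nat cabsX /dyadic_term natrX. Qed.

Lemma sum_cabs_dyadic_powers_sqr (z : R[i]) :
  \sum_(k < N.+1) cabs (z ^+ (2 ^ k)) ^+ 2 = dyadic_sum N.+1 (cabs z ^+ 2).
Proof. by apply: eq_bigr => k _; rewrite cabsX -!exprM mulnC. Qed.

Lemma disc_cabs (xy : plane) : disc xy -> 0 <= cabs (toC xy) < 1.
Proof. by move=> d; rewrite cabs_ge0. Qed.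

Let twoN : (0 : R) < (2 ^ N.+1)%:R. Proof. by rewrite ltr0n expn_gt0. Qed.

Lemma sqr_le_powR (s : R) : p <= 2 -> 0 <= s <= 1 -> s ^+ 2 <= s `^ p.
Proof.
move=> p2 /andP[]; rewrite le_eqVlt => /predU1P[<-|s0] s1.
  by rewrite expr0n powR_ge0.
by rewrite -powR_mulrn ?(ltW s0)// ger_powR// s0.
Qed.

Lemma powR_le_sqr (s : R) : 2 <= p -> 0 <= s <= 1 -> s `^ p <= s ^+ 2.
Proof.
move=> p2 /andP[]; rewrite le_eqVlt => /predU1P[<-|s0] s1.
  by rewrite powR0 ?sqr_ge0// gt_eqF.
by rewrite -powR_mulrn ?(ltW s0)// ger_powR// s0.
Qed.

Let pow01 (s : R) n : 0 <= s < 1 -> 0 <= s ^+ n <= 1.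
Proof. by move=> /andP[s0 s1]; rewrite exprn_ge0// exprn_ile1// ltW. Qed.

(** The left side is at most the integral of the |z|^(p 2^k) against omega, which
    the monomials compare with that of the powers of the terms of the derivative
    against [h]. The largest term is reached by averaging over signs, and Jensen
    bounds the average on the side of f. *)
Lemma bound_p_le2 (Cp : R) : p <= 2 -> 0 < Cp ->
  (forall r, 0 <= r < 1 -> exists2 m, (m < N.+1)%N &
    \sum_(k < N.+1) dyadic_term r k `^ p <= Cp * dyadic_term r m `^ p) ->
  (planar_int (fun xy => (dyadic_sum N.+1 (cabs (toC xy) ^+ 2) * omega (toC xy))%R) <=
   (C * (2 * Cp) * C)%:E * planar_int (fun xy =>
     ((2 * logf (cabs (toC xy) ^+ 2)) `^ (p / 2) * omega (toC xy))%R))%E.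
Proof.
move=> p2 Cp0 termC.
have [_ monoC] := @family_comparison _ _ monomials plus_sign (fun i k => expn_gt0 2 i).
have [signC _] := @family_comparison _ _ dyadic all_signs (fun i k => expn_gt0 2 k).
set X := planar_int _; set Y := planar_int _.
have XM : (X <= planar_int (family_sum monomials plus_sign))%E.
  apply: planar_int_le => xy d; have r01 := disc_cabs d.
  rewrite monomials_sumE mulr_ge0 ?dyadic_sum_ge0 ?sqr_ge0 ?omega0//=.
  rewrite ler_wpM2r ?omega0//; apply: ler_sum => k _.
  by rewrite -exprM mulnC exprM sqr_le_powR// pow01.
have MS : (planar_int (family_deriv_sum monomials plus_sign) <=
    planar_int (fun xy => (2 * Cp / (2 ^ N.+1)%:R * family_deriv_sum dyadic all_signs xy)%R))%E.
  apply: planar_int_le => xy d; have r01 := disc_cabs d.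
  rewrite family_deriv_sum_ge0//= monomials_deriv_sumE /family_deriv_sum -mulr_suml mulrA.
  rewrite ler_wpM2r ?h0//.
  have [m mN /le_trans] := termC _ r01; apply.
  have := moment_signed_sum_ge_term
    (fun k : 'I_N.+1 => (2 ^ k)%:R * toC xy ^+ (2 ^ k).-1) (Ordinal mN) p0.
  rewrite cabs_dyadic_term/= => hm.
  rewrite [2 * Cp]mulrC -!mulrA ler_wpM2l ?(ltW Cp0)//.
  by rewrite mulrCA ler_pdivlMl.
have SY : (planar_int (fun xy => ((2 ^ N.+1)%:R^-1 * family_sum dyadic all_signs xy)%R) <= Y)%E.
  apply: planar_int_le => xy d; have r01 := disc_cabs d.
  rewrite mulr_ge0 ?family_sum_ge0 ?invr_ge0 ?(ltW twoN)//=.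
  rewrite /family_sum -mulr_suml mulrA ler_wpM2r ?omega0//.
  rewrite ler_pdivrMl//.
  have := @moment_signed_sum_le R N.+1 p (fun k => toC xy ^+ (2 ^ k)).
  rewrite p0 p2 => /(_ isT) /le_trans; apply; rewrite ler_wpM2l ?(ltW twoN)//.
  rewrite sum_cabs_dyadic_powers_sqr; have t01 := unit_disc_sqr d.
  have p20 : 0 <= p / 2 by rewrite divr_ge0// ltW.
  apply: (ge0_ler_powR p20); rewrite ?nnegrE ?dyadic_sum_ge0 ?sqr_ge0//.
    by rewrite mulr_ge0// ltW// logf_gt0.
  exact: dyadic_sum_le.
have c0 : 0 <= 2 * Cp / (2 ^ N.+1)%:R.
  by rewrite divr_ge0 ?(ltW twoN)// mulr_ge0// ltW.
apply: (le_trans XM); apply: (le_trans monoC).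
rewrite -!mulrA EFinM -muleA; apply: lee_wpmul2l; first by rewrite lee_fin.
apply: (le_trans MS).
rewrite planar_intZ//; [|exact: measurable_family_deriv_sum|exact: family_deriv_sum_ge0].
apply: (@le_trans _ _ ((2 * Cp / (2 ^ N.+1)%:R)%:E *
  (C%:E * planar_int (family_sum dyadic all_signs)))%E).
  by apply: lee_wpmul2l; rewrite ?lee_fin.
have iN : 0 <= (2 ^ N.+1)%:R^-1 :> R by rewrite invr_ge0 ltW.
rewrite (planar_intZ iN (@measurable_family_sum _ _ dyadic all_signs)
  (@family_sum_ge0 _ _ dyadic all_signs)) in SY.
have -> A : ((2 * Cp / (2 ^ N.+1)%:R)%:E * (C%:E * A) =
    (2 * (Cp * C))%:E * ((2 ^ N.+1)%:R^-1%:E * A))%E.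
  by rewrite !muleA -!EFinM; congr (_%:E * _)%E; ring.
by apply: lee_wpmul2l => //; rewrite lee_fin !mulr_ge0// ltW.
Qed.

(** By Jensen the left side is at most the average over the signs of the norms of
    f, which is controlled by the derivative side. There the triangle inequality
    and the domination of the sum by its largest term leave the powers of the
    single terms, which the monomials bring back to the side of f. *)
Lemma bound_p_ge2 (C1 : R) : 2 <= p -> 0 < C1 ->
  (forall r, 0 <= r < 1 -> exists2 m, (m < N.+1)%N &
    \sum_(k < N.+1) dyadic_term r k `^ 1 <= C1 * dyadic_term r m `^ 1) ->
  (planar_int (fun xy => (dyadic_sum N.+1 (cabs (toC xy) ^+ 2) `^ (p / 2) * omega (toC xy))%R) <=
   (C * C1 `^ p * C)%:E * planar_int (fun xy =>
     ((2 * logf (cabs (toC xy) ^+ 2)) `^ 1 * omega (toC xy))%R))%E.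
Proof.
move=> p2 C10 termC.
have [monoC _] := @family_comparison _ _ monomials plus_sign (fun i k => expn_gt0 2 i).
have [_ signC] := @family_comparison _ _ dyadic all_signs (fun i k => expn_gt0 2 k).
set X := planar_int _; set Y := planar_int _.
have iN : 0 <= (2 ^ N.+1)%:R^-1 :> R by rewrite invr_ge0 ltW.
have XS : (X <= (2 ^ N.+1)%:R^-1%:E * planar_int (family_sum dyadic all_signs))%E.
  rewrite -planar_intZ//; [|exact: measurable_family_sum|exact: family_sum_ge0].
  apply: planar_int_le => xy d.
  rewrite mulr_ge0 ?powR_ge0 ?omega0//=.
  rewrite /family_sum -mulr_suml mulrA ler_wpM2r ?omega0//.
  rewrite ler_pdivlMl// -(sum_cabs_dyadic_powers_sqr (toC xy)).
  exact: (@moment_signed_sum_ge R N.+1 p (fun k => toC xy ^+ (2 ^ k)) p2).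
have SM : ((2 ^ N.+1)%:R^-1%:E * planar_int (family_deriv_sum dyadic all_signs) <=
    (C1 `^ p)%:E * planar_int (family_deriv_sum monomials plus_sign))%E.
  rewrite -!planar_intZ ?powR_ge0//;
    try solve [exact: measurable_family_deriv_sum|exact: family_deriv_sum_ge0].
  apply: planar_int_le => xy d; have r01 := disc_cabs d.
  rewrite mulr_ge0 ?family_deriv_sum_ge0//=.
  rewrite monomials_deriv_sumE /family_deriv_sum -mulr_suml !mulrA.
  rewrite ler_wpM2r ?h0// ler_pdivrMl// -sum_signs_cst; apply: ler_sum => e _.
  have [m mN hm] := termC _ r01.
  apply: (@le_trans _ _ ((C1 * dyadic_term (cabs (toC xy)) m) `^ p)).
    apply: (ge0_ler_powR (ltW p0)); rewrite ?nnegrE ?cabs_ge0//.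
      by apply: mulr_ge0; [exact: ltW|apply: dyadic_term_ge0; exact: cabs_ge0].
    apply: (le_trans (cabs_sum _)).
    rewrite powRr1 in hm; last by apply: dyadic_term_ge0; exact: cabs_ge0.
    apply: le_trans hm; apply: ler_sum => k _.
    rewrite powRr1; last by apply: dyadic_term_ge0; exact: cabs_ge0.
    by rewrite cabsM cabs_sign mul1r cabs_dyadic_term.
  rewrite powRM ?(ltW C10)//; last by apply: dyadic_term_ge0; exact: cabs_ge0.
  rewrite ler_wpM2l ?powR_ge0//.
  rewrite (bigD1 (Ordinal mN))//= lerDl; apply: sumr_ge0 => k _; exact: powR_ge0.
have MY : (planar_int (family_sum monomials plus_sign) <= Y)%E.
  apply: planar_int_le => xy d; have r01 := disc_cabs d; have t01 := unit_disc_sqr d.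
  rewrite family_sum_ge0//= monomials_sumE ler_wpM2r ?omega0//.
  rewrite powRr1; last by rewrite mulr_ge0// ltW// logf_gt0.
  apply: le_trans (dyadic_sum_le N.+1 t01); apply: ler_sum => k _.
  by rewrite -exprM mulnC exprM powR_le_sqr// pow01.
apply: (le_trans XS).
apply: (@le_trans _ _ ((2 ^ N.+1)%:R^-1%:E *
  (C%:E * planar_int (family_deriv_sum dyadic all_signs)))%E).
  by apply: lee_wpmul2l.
rewrite muleCA -!mulrA EFinM -muleA; apply: lee_wpmul2l; first by rewrite lee_fin.
apply: (le_trans SM); rewrite EFinM -muleA; apply: lee_wpmul2l; first by rewrite lee_fin powR_ge0.
by apply: (le_trans monoC); apply: lee_wpmul2l; rewrite ?lee_fin.
Qed.

End Contradiction.

Section UnboundedComparison.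
Context {R : realType}.
Local Notation disc := (@toC R @^-1` @unit_disc R : set (measurableTypeR R * measurableTypeR R)).

Lemma planar_int_log_weight_lty (b : R) : 1 < b ->
  (planar_int (fun xy => log_weight b (toC xy)) < +oo)%E.
Proof.
move=> /weight_log_weight[_ /integrableP[_]]; apply: le_lt_trans.
apply: le_lower_integral => xy d; first by rewrite lee_fin log_weight_ge0.
by rewrite /= lee_fin ler_norm.
Qed.

(** The right side of [bound] is finite because [c < b], while the left side is
    unbounded in [N]. *)
Lemma not_comparable (p b c K : R) (phi : R -> R) : 0 < p -> 0 < b -> 0 <= c ->
  c < b -> 0 < K ->
  (forall (C : R) (h : measurableTypeR R * measurableTypeR R -> R) (N : nat), 0 <= C ->
    measurable_fun disc h -> (forall xy, disc xy -> 0 <= h xy) ->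
    comparable_on_power_sums p (log_weight (b + 1)) C h ->
    (planar_int (fun xy => (dyadic_sum N.+1 (cabs (toC xy) ^+ 2) `^ b *
        log_weight (b + 1) (toC xy))%R) <=
     (C * K * C)%:E * planar_int (fun xy =>
       ((2 * logf (cabs (toC xy) ^+ 2)) `^ c * log_weight (b + 1) (toC xy))%R))%E) ->
  ~ exists2 C : R, 1 <= C &
    forall f : R[i]^o -> R[i]^o, analytic_in_disc f ->
      (C^-1%:E * derivative_normp p (log_weight (b + 1)) phi f
         <= bergman_normp p (log_weight (b + 1)) f
         <= C%:E * derivative_normp p (log_weight (b + 1)) phi f)%E.
Proof.
move=> p0 b0 c0 cb K0 bound [C C1 H].
have b1 : 1 < b + 1 by lra.
have C0 : 0 <= C by lra.
have [h [mh h0 cmp]] := borel_comparison p0 (@log_weight_ge0 R (b + 1)) C1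
  (planar_int_log_weight_lty b1) H.
have := disc_int_logf_lty c0 (_ : c + 1 < b + 1); rewrite ltrD2r => /(_ cb).
set Y := disc_int _ => Yoo.
have Y0 : (0 <= Y)%E.
  by apply: planar_int_ge0 => xy d; rewrite mulr_ge0 ?powR_ge0 ?log_weight_ge0.
have Yfin : Y \is a fin_num by rewrite ge0_fin_numE.
have [N] := disc_int_dyadic_sum_unbounded (C * K * C * fine Y + 1) b0.
apply/negP; rewrite -ltNge; apply: le_lt_trans (bound C h N C0 mh h0 cmp) _.
rewrite -[planar_int _]/Y -(fineK Yfin) -EFinM lte_fin/=; lra.
Qed.

End UnboundedComparison.

Theorem proposition4p3 (R : realType) (p : R) (hp0 : 0 < p) (hp2 : p != 2) :
  exists omega : R[i]^o -> R,
    rapidly_increasing omega /\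
    forall phi : R -> R,
      (forall r, 0 <= r < 1 -> 0 < phi r) ->
      lebesgue_measurable_on01 phi ->
      ~ exists2 C : R, 1 <= C &
          forall f : R[i]^o -> R[i]^o, analytic_in_disc f ->
            (C^-1%:E * derivative_normp p omega phi f
               <= bergman_normp p omega f
               <= C%:E * derivative_normp p omega phi f)%E.
Proof.
have [p2|p2|p2] := ltgtP p 2; last by rewrite p2 eqxx in hp2.
- exists (log_weight (1 + 1)); split.
    by apply: rapidly_increasing_log_weight; lra.
  move=> phi _ _; have [Cp Cp0 termC] := sum_dyadic_term_le hp0.
  apply: (@not_comparable _ p 1 (p / 2) (2 * Cp)) => //; try lra.
  move=> C h N C0 mh h0 cmp.
  have := @bound_p_le2 R p _ C h hp0 (measurable_log_weight (1 + 1))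
    (@log_weight_ge0 _ _) mh h0 C0 cmp N Cp (ltW p2) Cp0
    (fun r r01 => termC r N.+1 r01 isT).
  apply: le_trans; apply: planar_int_le => xy d.
  rewrite powRr1 ?dyadic_sum_ge0 ?sqr_ge0// lexx andbT.
  by rewrite mulr_ge0 ?dyadic_sum_ge0 ?sqr_ge0 ?log_weight_ge0.
- exists (log_weight (p / 2 + 1)); split.
    by apply: rapidly_increasing_log_weight; lra.
  move=> phi _ _; have [C1 C10 termC] := sum_dyadic_term_le (@ltr01 R).
  apply: (@not_comparable _ p (p / 2) 1 (C1 `^ p)) => //; rewrite ?powR_gt0//; try lra.
  move=> C h N C0 mh h0 cmp.
  exact: (@bound_p_ge2 R p _ C h hp0 (measurable_log_weight (p / 2 + 1))
    (@log_weight_ge0 _ _) mh h0 C0 cmp N C1 (ltW p2) C10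
    (fun r r01 => termC r N.+1 r01 isT)).
Qed.
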